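(* Let $f:(0,\infty)\to(0,1]$ be a function that decreases to zero and is regularly varying at infinity with index of regular variation $-\gamma$, where $\gamma\in[0,1)$. Let $\omega_t$ be the clique number of the random multigraph $G_t(f)$. Then $$ \lim_{t\to\infty}\frac{\log\omega_t}{\log t}=\frac{1-\gamma}{2}\quad\text{almost surely.} $$
   Context: Multigraphs may have loops and multiple edges; a loop contributes 2 to the degree of its vertex. For a finite connected multigraph $G$, $\pi_G$ is the probability distribution on its vertices $\pi_G(v)=\deg(v)/\sum_{w\in G}\deg(w)$. Process $G_t(f)$: let $(Z_t)_{t\ge1}$ be independent with $Z_t\sim\mathrm{Ber}(f(t))$. $G_0$ is one vertex with one self-loop. Given $G_t$ and independently of the past: if $Z_{t+1}=1$ (vertex-step), add a new vertex and connect it by one edge to a vertex of $G_t$ chosen according to $\pi_{G_t}$; if $Z_{t+1}=0$ (edge-step), add a new edge between two vertices of $G_t$ chosen independently, each according to $\pi_{G_t}$ (possibly creating a loop or a multiple edge). The result is $G_{t+1}$. The clique number of a multigraph is the largest size of a set of pairwise adjacent vertices. A function $f:(0,\infty)\to(0,\infty)$ is regularly varying at infinity with index $\beta\in\mathbb{R}$ if $\lim_{t\to\infty}f(at)/f(t)=a^{\beta}$ for all $a>0$. *)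

(* Defs.v *)
From HB Require Import structures.
From mathcomp Require Import all_boot all_order all_algebra.
From mathcomp Require Import all_classical all_reals all_analysis.
Set Implicit Arguments.
Unset Strict Implicit.
Unset Printing Implicit Defensive.
Import Order.TTheory GRing.Theory Num.Theory.
Import numFieldNormedType.Exports.

Local Open Scope classical_set_scope.
Local Open Scope ring_scope.

(* The vertices are 0, ..., n - 1 where n is the first component, and the list
   gives the ends of each edge; the unordered pair of ends {u, v} is represented
   by (u, v) with u <= v, so that a loop is a pair (u, u). *)
Record multigraph := Multigraph {
  verts_edges : nat * seq (nat * nat);
  _ : all (fun e : nat * nat => (e.1 <= e.2 < verts_edges.1)%N) verts_edges.2 }.

HB.instance Definition _ := [isSub for verts_edges].
HB.instance Definition _ := [Countable of multigraph by <:].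

Definition nverts (g : multigraph) : nat := (verts_edges g).1.
Definition edges (g : multigraph) : seq (nat * nat) := (verts_edges g).2.

Definition upair (u v : nat) : nat * nat := (minn u v, maxn u v).

Lemma loop_graph_subproof :
  all (fun e : nat * nat => (e.1 <= e.2 < 1)%N) [:: (0, 0)%N].
Proof. by []. Qed.

Definition loop_graph : multigraph :=
  @Multigraph (1, [:: (0, 0)])%N loop_graph_subproof.

Lemma add_vertex_subproof (g : multigraph) (u : 'I_(nverts g)) :
  all (fun e : nat * nat => (e.1 <= e.2 < (nverts g).+1)%N)
      (upair u (nverts g) :: edges g).
Proof.
apply/andP; split=> /=.
  have lt_u := ltn_ord u.
  by rewrite /upair (minn_idPl (ltnW lt_u)) (maxn_idPr (ltnW lt_u)) ltnW /=.
apply: sub_all (valP g) => e /andP[-> /=]; exact: leqW.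
Qed.

(* The new vertex gets the label nverts g. *)
Definition add_vertex (g : multigraph) (u : 'I_(nverts g)) : multigraph :=
  @Multigraph ((nverts g).+1, upair u (nverts g) :: edges g)
    (add_vertex_subproof u).

Lemma add_edge_subproof (g : multigraph) (u v : 'I_(nverts g)) :
  all (fun e : nat * nat => (e.1 <= e.2 < nverts g)%N) (upair u v :: edges g).
Proof.
apply/andP; split=> /=; last exact: (valP g).
by rewrite gtn_max !ltn_ord andbT geq_min !leq_max leqnn.
Qed.

Definition add_edge (g : multigraph) (u v : 'I_(nverts g)) : multigraph :=
  @Multigraph (nverts g, upair u v :: edges g) (add_edge_subproof u v).

Definition deg (g : multigraph) (v : nat) : nat :=
  (\sum_(e <- edges g) ((e.1 == v) + (e.2 == v)))%N.

Definition adjacent (g : multigraph) (u v : nat) : bool :=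
  upair u v \in edges g.

Definition is_clique (g : multigraph) (S : {set 'I_(nverts g)}) : bool :=
  [forall u in S, forall v in S, (u != v) ==> adjacent g u v].

Definition clique_number (g : multigraph) : nat :=
  (\max_(S : {set 'I_(nverts g)} | is_clique S) #|S|)%N.

Section Process.
Context {R : realType}.

Definition degree_dist (g : multigraph) (v : 'I_(nverts g)) : R :=
  (deg g v)%:R / (\sum_(w < nverts g) deg g w)%:R.

(* Conditional probability that the next graph is h, given that the current one
   is g and that the step is a vertex-step (b = true) or an edge-step
   (b = false). *)
Definition transition (b : bool) (g h : multigraph) : R :=
  if b then \sum_(u < nverts g) degree_dist u * (h == add_vertex u)%:R
  else \sum_(u < nverts g) \sum_(v < nverts g)
         degree_dist u * degree_dist v * (h == add_edge u v)%:R.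

Definition mutually_independent d d' (T : measurableType d)
    (T' : measurableType d') (P : probability T R)
    (X : nat -> {RV P >-> T'}) : Prop :=
  forall (s : seq nat) (A : nat -> set T'), uniq s ->
    (forall i, measurable (A i)) ->
    P (\bigcap_(i in [set` s]) (X i @^-1` A i)) =
    (\prod_(i <- s) P (X i @^-1` A i))%E.

(* The event that Z_1, ..., Z_t and G_0, ..., G_t take the values z and g. *)
Definition past (T : Type) (Z : nat -> T -> bool) (G : nat -> T -> multigraph)
    (t : nat) (z : nat -> bool) (g : nat -> multigraph) : set T :=
  [set w | (forall s, (1 <= s <= t)%N -> Z s w = z s) /\
           (forall s, (s <= t)%N -> G s w = g s)].

(* Z 0 plays no role. As multigraph is countable, measurability of G t amounts
   to that of the events G t = g. *)
Record edge_step_process d (T : measurableType d) (P : probability T R)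
    (f : R -> R) (Z : nat -> {RV P >-> bool}) (G : nat -> T -> multigraph) :
    Prop := {
  step_bernoulli : forall t : nat,
    distribution P (Z t.+1) =1 bernoulli_prob (f t.+1%:R);
  step_independent : mutually_independent (fun t => Z t.+1);
  graph_measurable : forall t g, measurable (G t @^-1` [set g]);
  graph_start : {ae P, forall w, G 0%N w = loop_graph};
  step_independent_past : forall t z g b,
    P (past Z G t z g `&` Z t.+1 @^-1` [set b]) =
    (P (past Z G t z g) * P (Z t.+1 @^-1` [set b]))%E;
  graph_transition : forall t z g b h,
    P (past Z G t z g `&` Z t.+1 @^-1` [set b] `&` G t.+1 @^-1` [set h]) =
    (P (past Z G t z g `&` Z t.+1 @^-1` [set b]) *
     (transition b (g t) h)%:E)%E }.

Definition regularly_varying (f : R -> R) (beta : R) : Prop :=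
  (forall x, 0 < x -> 0 < f x) /\
  forall a, 0 < a -> f (a * x) / f x @[x --> +oo] --> a `^ beta.

End Process.

(* Main.v *)
(* The process is compared at geometric times. Write r = 2^-gamma, so that
   f (2^k) is r^k up to subexponential factors.

   Upper bound. At time t = 4^k let the early vertices be those born before time
   s = 2^k; there are about (2r)^k of them. The late vertices have total degree
   about f(s) u at each time u in [s, t], so that about t f(s)^2, i.e. (2r)^(2k),
   edges join two late vertices, and a clique has at most of the order of (2r)^k
   late vertices.

   Lower bound. Let s = 2^(Nk) and t = 2^((2N+4)k). There are about (2r)^(Nk)
   vertices at time s. Apart from a small proportion of them, these have degree
   at least K = 2^((N+3)k) at time t, by Markov's inequality for the sum of
   1 / (degree - c) with c close to 1. As K^2 / t = 4^k, the vertices of large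
   degree become pairwise adjacent between the times t and 2t. Finally N tends to
   infinity.

   Every probability involved is bounded by a geometric sequence in k, so that
   the Borel-Cantelli lemma applies, and the monotonicity of the clique number
   deals with the times in between. *)
Require Import Defs.
From HB Require Import structures.
From mathcomp Require Import all_boot all_order all_algebra.
From mathcomp Require Import all_classical all_reals all_analysis.
From mathcomp Require Import zify ring lra.
Set Implicit Arguments.
Unset Strict Implicit.
Unset Printing Implicit Defensive.
Import Order.TTheory GRing.Theory Num.Theory.
Import numFieldNormedType.Exports.
Local Open Scope classical_set_scope.
Local Open Scope ring_scope.

(** * Degrees and the transition operator *)

(** The law of the process is given on cylinder events only, so probabilities are bounded through
    [Ex], an iterated finite averaging operator: the Markov property is [Ex_add], and the estimates
    reduce to one-step inequalities for well-chosen functions of the graph.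

    The time scales come from two comparisons. For the upper bound, a cut at time s leaves about s
    f(s) early vertices and about sqrt(t) f(s) late clique vertices; these agree when t = s^2. For
    the lower bound, f tends to 0, so most steps are edge-steps, with two new ends, and the degree
    of an early vertex grows nearly like t / s instead of sqrt(t / s). Two such vertices get joined
    around time t once (t / s)^2 exceeds t, that is, once t exceeds s^2. The surplus 4k in the
    exponent of t pays for two losses: K falls short of t / s = 2^((N+4)k) by a factor 2^k, which
    covers the imperfect growth rate, and K^2 / t = 4^k makes a missing edge unlikely enough for a
    union bound over about s^2 pairs. The resulting exponent is (1 - gamma) N / (2N + 4). *)

Section DegreeCounts.
Implicit Types (a : pred nat) (g : multigraph).
Local Open Scope nat_scope.

(** Counting edge ends makes the effect of one new edge immediate. The cases used are [pred1 v] (the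
    degree of [v]), [predT] (twice the number of edges) and [leq n] (the vertices born late). *)
Definition total_deg a g : nat := \sum_(e <- edges g) (a e.1 + a e.2).

Lemma upair_sum a u v : a (upair u v).1 + a (upair u v).2 = a u + a v.
Proof. by rewrite /upair /minn /maxn; case: ifP => //= _; rewrite addnC. Qed.

Lemma total_deg_add_vertex a g (u : 'I_(nverts g)) :
  total_deg a (add_vertex u) = a u + a (nverts g) + total_deg a g.
Proof. by rewrite /total_deg big_cons upair_sum. Qed.

Lemma total_deg_add_edge a g (u v : 'I_(nverts g)) :
  total_deg a (add_edge u v) = a u + a v + total_deg a g.
Proof. by rewrite /total_deg big_cons upair_sum. Qed.

Lemma edge_bound g e : e \in edges g -> e.1 <= e.2 < nverts g.
Proof. by move=> eg; exact: (allP (valP g) e eg). Qed.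

Lemma sum_pick_ord a n x : x < n -> \sum_(w < n | a w) (x == w) = a x.
Proof.
move=> xn; rewrite big_mkcond (bigD1 (Ordinal xn)) //= eqxx big1 ?addn0.
  by case: (a x).
by move=> i; rewrite -val_eqE /= eq_sym => /negPf ->; rewrite if_same.
Qed.

Lemma total_degE a g : total_deg a g = \sum_(w < nverts g | a w) deg g w.
Proof.
rewrite /deg exchange_big; apply: eq_big_seq => e /edge_bound /andP[le_e lt_e].
by rewrite big_split /= !sum_pick_ord // (leq_ltn_trans le_e).
Qed.

Lemma total_degT g : total_deg predT g = (size (edges g)).*2.
Proof. by rewrite /total_deg big_split /= sum1_size addnn. Qed.

Lemma deg_add_vertex g (u : 'I_(nverts g)) v :
  deg (add_vertex u) v = (u == v :> nat) + (nverts g == v) + deg g v.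
Proof. exact: (total_deg_add_vertex (pred1 v)). Qed.

Lemma deg_add_edge g (x y : 'I_(nverts g)) v :
  deg (add_edge x y) v = (x == v :> nat) + (y == v :> nat) + deg g v.
Proof. exact: (total_deg_add_edge (pred1 v)). Qed.

(** Deterministic stand-in for being a possible value of the process at time [t]. As the initial
    graph already has a loop, there are [t.+1] edges, and [degree_dist] is normalised by
    [2 * t.+1]. *)
Definition reachable (t : nat) g : Prop :=
  [/\ size (edges g) = t.+1, 0 < nverts g <= t.+1 &
      forall v, v < nverts g -> 0 < deg g v].

Lemma reachable_loop : reachable 0 loop_graph.
Proof. by split=> // -[|//] _; rewrite /deg big_seq1. Qed.

Lemma reachable_add_vertex t g (u : 'I_(nverts g)) :
  reachable t g -> reachable t.+1 (add_vertex u).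
Proof.
move=> [sz nv dg]; split; first by rewrite /= sz.
  by rewrite /nverts /= ltnS; case/andP: nv.
move=> v; rewrite /nverts /= -/(nverts g) ltnS leq_eqVlt deg_add_vertex.
by case/orP => [/eqP ->|/dg dv]; rewrite ?eqxx ?addn1 // ltn_addl.
Qed.

Lemma reachable_add_edge t g (x y : 'I_(nverts g)) :
  reachable t g -> reachable t.+1 (add_edge x y).
Proof.
move=> [sz /andP[nv0 nv] dg]; split; first by rewrite /= sz.
  by rewrite nv0 leqW.
by move=> v /dg dv; rewrite deg_add_edge ltn_addl.
Qed.

End DegreeCounts.

Section OneStep.
Context {R : realType}.
Implicit Types (a : pred nat) (g : multigraph) (p : R).

Lemma degree_dist_ge0 g (u : 'I_(nverts g)) : 0 <= degree_dist u :> R.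
Proof. by rewrite /degree_dist divr_ge0 // ler0n. Qed.

Lemma sum_degree_dist a t g : reachable t g ->
  \sum_(w < nverts g) degree_dist w * (a w)%:R =
  (total_deg a g)%:R / (2 * t.+1%:R) :> R.
Proof.
move=> [sz _ _]; rewrite total_degE [in RHS]big_mkcond /= natr_sum mulr_suml.
have totE : (\sum_(w < nverts g) deg g w = 2 * t.+1)%N.
  by rewrite -sz mul2n -total_degT total_degE.
apply: eq_bigr => w _; rewrite /degree_dist totE natrM.
by case: (a w); rewrite ?mulr1 // mulr0 mul0r.
Qed.

Lemma sum_degree_dist1 t g : reachable t g ->
  \sum_(w < nverts g) degree_dist w = 1 :> R.
Proof.
move=> rg; transitivity (\sum_(w < nverts g) degree_dist w * (predT w)%:R : R).
  by apply: eq_bigr => w _; rewrite mulr1.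
rewrite (@sum_degree_dist predT _ _ rg) total_degT; case: rg => -> _ _.
by rewrite -mul2n natrM divff // mulf_neq0 ?pnatr_eq0.
Qed.

Definition step_mean (b : bool) (phi : multigraph -> R) g : R :=
  if b then \sum_(u < nverts g) degree_dist u * phi (add_vertex u)
  else \sum_(u < nverts g) \sum_(v < nverts g)
         degree_dist u * degree_dist v * phi (add_edge u v).

Definition step p (phi : multigraph -> R) g : R :=
  p * step_mean true phi g + (1 - p) * step_mean false phi g.

Lemma ler_step p (phi psi : multigraph -> R) g : 0 <= p <= 1 ->
  (forall u, phi (@add_vertex g u) <= psi (add_vertex u)) ->
  (forall u v, phi (@add_edge g u v) <= psi (add_edge u v)) ->
  step p phi g <= step p psi g.
Proof.
move=> /andP[p0 p1] hv he; apply: lerD; apply: ler_wpM2l => //.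
- by apply: ler_sum => u _; apply: ler_wpM2l => //; exact: degree_dist_ge0.
- by rewrite subr_ge0.
- apply: ler_sum => u _; apply: ler_sum => v _; apply: ler_wpM2l => //.
  by rewrite mulr_ge0 // degree_dist_ge0.
Qed.

Lemma stepD p (phi psi : multigraph -> R) g :
  step p (fun h => phi h + psi h) g = step p phi g + step p psi g.
Proof.
rewrite /step /step_mean addrACA -!mulrDr -!big_split /=; congr (_ * _ + _ * _).
  by apply: eq_bigr => u _; rewrite mulrDr.
apply: eq_bigr => u _; rewrite -big_split /=.
by apply: eq_bigr => v _; rewrite mulrDr.
Qed.

Lemma stepZ p c (phi : multigraph -> R) g :
  step p (fun h => c * phi h) g = c * step p phi g.
Proof.
rewrite /step /step_mean mulrDr !(mulrCA c); congr (_ * _ + _ * _); rewrite mulr_sumr.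
  by apply: eq_bigr => u _; rewrite mulrCA.
apply: eq_bigr => u _; rewrite mulr_sumr.
by apply: eq_bigr => v _; rewrite mulrCA.
Qed.

Lemma step_sum p I (r : seq I) (phi : I -> multigraph -> R) g :
  step p (fun h => \sum_(i <- r) phi i h) g = \sum_(i <- r) step p (phi i) g.
Proof.
elim: r => [|i r IHr].
  rewrite big_nil -[RHS](mul0r (step p (fun=> 0) g)) -stepZ; congr step.
  by apply/funext => h; rewrite big_nil mulr0.
rewrite big_cons -IHr -stepD; congr step.
by apply/funext => h; rewrite big_cons.
Qed.

(** [m] is the probability that an end drawn from the degree distribution lies in [a]; the two ends
    of an edge-step are independent, so the product of their indicators has mean [m ^+ 2]. *)
Lemma step_affine p a t g (phi : multigraph -> R) A B A' B' C' :
  reachable t g ->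
  (forall u, phi (@add_vertex g u) = A + B * (a u)%:R) ->
  (forall u v, phi (@add_edge g u v) =
     A' + B' * ((a u)%:R + (a v)%:R) + C' * ((a u)%:R * (a v)%:R)) ->
  let m := (total_deg a g)%:R / (2 * t.+1%:R) in
  step p phi g = p * (A + B * m) + (1 - p) * (A' + B' * (2 * m) + C' * m ^+ 2).
Proof.
move=> rg hv he m; have sum1 := sum_degree_dist1 rg.
have summ := @sum_degree_dist a _ _ rg; rewrite -/m in summ.
rewrite /step /step_mean; congr (_ * _ + _ * _).
  under eq_bigr do rewrite hv mulrDr (mulrCA _ B).
  by rewrite big_split /= -mulr_suml -mulr_sumr sum1 summ mul1r.
transitivity (\sum_(u < nverts g) degree_dist u *
    (A' + B' * (a u)%:R + B' * m + C' * (a u)%:R * m)).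
  apply: eq_bigr => u _.
  transitivity (\sum_(v < nverts g) (degree_dist u * (A' + B' * (a u)%:R) *
     degree_dist v + degree_dist u * (B' + C' * (a u)%:R) *
      (degree_dist v * (a v)%:R))).
    by apply: eq_bigr => v _; rewrite he; ring.
  by rewrite big_split /= -!mulr_sumr sum1 summ; ring.
transitivity (\sum_(u < nverts g) ((A' + B' * m) * degree_dist u +
   (B' + C' * m) * (degree_dist u * (a u)%:R))).
  by apply: eq_bigr => u _; ring.
by rewrite big_split /= -!mulr_sumr sum1 summ; ring.
Qed.

Lemma step_cst p t g c : reachable t g -> step p (fun=> c) g = c.
Proof.
move=> rg; rewrite (@step_affine p predT t g _ c 0 c 0 0 rg); first by ring.
  by move=> u; ring.
by move=> u v; ring.
Qed.

End OneStep.

(** * Expectations as iterated one-step means *)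

Section Expectation.
Context {R : realType} (f : R -> R).
Hypothesis f01 : forall t : nat, 0 <= f t.+1%:R <= 1.
Implicit Types (g : multigraph) (phi psi : multigraph -> R).

(* Ex s k phi g is the expectation of phi at time s + k of the process that is
   at g at time s; the recursion peels off the last step. *)
Fixpoint Ex (s k : nat) phi g : R :=
  if k is k'.+1 then Ex s k' (step (f (s + k').+1%:R) phi) g else phi g.

Lemma Ex_add s k l phi g : Ex s (k + l) phi g = Ex s k (Ex (s + k) l phi) g.
Proof.
elim: l phi => [|l IHl] phi; first by rewrite addn0.
by rewrite addnS /= IHl addnA.
Qed.

Lemma ExD s k phi psi g :
  Ex s k (fun h => phi h + psi h) g = Ex s k phi g + Ex s k psi g.
Proof.
elim: k phi psi => [|k IHk] phi psi //=; rewrite -IHk; congr Ex.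
by apply/funext => h; rewrite stepD.
Qed.

Lemma ExZ s k c phi g : Ex s k (fun h => c * phi h) g = c * Ex s k phi g.
Proof.
elim: k phi => [|k IHk] phi //=; rewrite -IHk; congr Ex.
by apply/funext => h; rewrite stepZ.
Qed.

Lemma Ex_sum s k I (r : seq I) (phi : I -> multigraph -> R) g :
  Ex s k (fun h => \sum_(i <- r) phi i h) g = \sum_(i <- r) Ex s k (phi i) g.
Proof.
elim: k phi => [|k IHk] phi //=; rewrite -IHk; congr Ex.
by apply/funext => h; rewrite step_sum.
Qed.

(** Almost sure properties of the trajectory are replaced by predicates that survive every
    conceivable step, whatever its probability. *)
Definition stable (J : nat -> multigraph -> Prop) : Prop :=
  forall t g, J t g -> (forall u, J t.+1 (@add_vertex g u)) /\
    (forall u v, J t.+1 (@add_edge g u v)).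

Lemma stable_reachable : stable reachable.
Proof.
move=> t g rg; split=> [u|u v].
  exact: reachable_add_vertex.
exact: reachable_add_edge.
Qed.

Section Invariant.
Variable J : nat -> multigraph -> Prop.
Hypothesis stableJ : stable J.

Lemma ler_Ex s k phi psi g : (forall h, J (s + k) h -> phi h <= psi h) ->
  J s g -> Ex s k phi g <= Ex s k psi g.
Proof.
elim: k phi psi => [|k IHk] phi psi le_phi Jg /=.
  by apply: le_phi; rewrite addn0.
apply: IHk => // h /stableJ[Jv Je]; rewrite -addnS in Jv Je.
by apply: ler_step => // *; apply: le_phi.
Qed.

(** The hypothesis is applied to the last step, then inductively. Letting [phi] depend on time
    allows potentials whose coefficients account for the steps left. *)
Lemma Ex_supermartingale s k (phi : nat -> multigraph -> R) g :
  (forall i h, (i < k)%N -> J (s + i) h ->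
     step (f (s + i).+1%:R) (phi i.+1) h <= phi i h) ->
  J s g -> Ex s k (phi k) g <= phi 0%N g.
Proof.
elim: k => [//|k IHk] hphi Jg /=.
apply: (@le_trans _ _ (Ex s k (phi k) g)).
  by apply: ler_Ex => // h; exact: hphi.
by apply: IHk => // i h ik; apply: hphi; exact: leqW.
Qed.

Lemma Ex_prod s k (c : nat -> R) phi g :
  (forall i, (i < k)%N -> 0 <= c i) ->
  (forall i h, (i < k)%N -> J (s + i) h ->
     step (f (s + i).+1%:R) phi h <= c i * phi h) ->
  J s g -> Ex s k phi g <= (\prod_(i < k) c i) * phi g.
Proof.
elim: k => [|k IHk] c0 hphi Jg /=; first by rewrite big_ord0 mul1r.
apply: (@le_trans _ _ (Ex s k (fun h => c k * phi h) g)).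
  by apply: ler_Ex => // h; exact: hphi.
rewrite ExZ big_ord_recr /= (mulrC _ (c k)) -mulrA; apply: ler_wpM2l; first exact: c0.
by apply: IHk => // [i ik|i h ik]; [apply: c0|apply: hphi]; exact: leqW.
Qed.

End Invariant.

Lemma Ex_cst s k c g : reachable s g -> Ex s k (fun=> c) g = c.
Proof.
move=> rg; apply/eqP; rewrite eq_le; apply/andP; split.
  apply: (@Ex_supermartingale _ stable_reachable s k (fun _ _ => c)) => //.
  by move=> i h _ /step_cst ->.
have := @Ex_supermartingale _ stable_reachable s k (fun _ _ => -1 * c) g.
rewrite ExZ !mulN1r lerN2; apply=> //.
by move=> i h _ /step_cst ->.
Qed.

Lemma Ex_ge0 s k phi g : (forall h, reachable (s + k) h -> 0 <= phi h) ->
  reachable s g -> 0 <= Ex s k phi g.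
Proof.
by move=> phi0 rg; rewrite -(Ex_cst k 0 rg); apply: (ler_Ex stable_reachable).
Qed.

End Expectation.

(** * The law of the process *)

Section Law.
Context {R : realType} (f : R -> R) d (T : measurableType d)
  (P : probability T R) (Z : nat -> {RV P >-> bool}) (G : nat -> T -> multigraph).
Hypothesis f01 : forall t : nat, 0 <= f t.+1%:R <= 1.
Hypothesis process : edge_step_process f Z G.

Let history := seq (bool * multigraph).
Let start : bool * multigraph := (false, loop_graph).

(* Z 0 is masked because the law of the process says nothing about it. *)
Definition hist (t : nat) (w : T) : history :=
  mkseq (fun i => ((0 < i)%N && Z i w, G i w)) t.+1.

Lemma hist_last t w : (last start (hist t w)).2 = G t w.
Proof.
pose F i := ((0 < i)%N && Z i w, G i w).
by rewrite /hist (last_nth start) size_mkseq /= (nth_mkseq _ F).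
Qed.

Lemma histS t w : hist t.+1 w = rcons (hist t w) (Z t.+1 w, G t.+1 w).
Proof. by rewrite /hist [LHS]mkseqS. Qed.

Lemma hist_past t (p : history) : size p = t.+1 -> (nth start p 0).1 = false ->
  [set w | hist t w = p] =
  past Z G t (fun i => (nth start p i).1) (fun i => (nth start p i).2).
Proof.
move=> sz p0; apply/seteqP; split => w /=.
  move=> <-; split=> i; rewrite /hist => it.
    by rewrite nth_mkseq /=; case: i it => [|i] //= it; rewrite ltnS.
  by rewrite nth_mkseq.
move=> [hz hg]; apply: (@eq_from_nth _ start); first by rewrite size_mkseq sz.
move=> i; rewrite size_mkseq => it; rewrite nth_mkseq // hg //.
case: i it => [|i] it; first by rewrite [LHS]surjective_pairing /= -p0 -surjective_pairing.
by rewrite hz //= -surjective_pairing.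
Qed.

Lemma measurable_graph t g : measurable [set w | G t w = g].
Proof. exact: (graph_measurable process). Qed.

Lemma measurable_Z t b : measurable [set w | Z t w = b].
Proof. by rewrite -[X in measurable X]/(Z t @^-1` [set b]); exact: measurable_funPTI. Qed.

Lemma measurable_fiberP (C : countType) (X : T -> C) (a : set C) :
  (forall c, measurable [set w | X w = c]) -> measurable (X @^-1` a).
Proof.
move=> mX; have -> : X @^-1` a = \bigcup_(c : C) ([set w | X w = c] `&` [set w | a c]).
  apply/seteqP; split => w /=; first by exists (X w).
  by move=> [c _ [/= <-]].
apply: countable_bigcupT_measurable => // c; apply: measurableI => //.
case: (pselect (a c)) => ac.
  by rewrite (_ : [set _ | _] = setT) //; apply/seteqP; split.
by rewrite (_ : [set _ | _] = set0) //; apply/seteqP; split.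
Qed.

Lemma measurable_hist t p : measurable [set w | hist t w = p].
Proof.
elim: t p => [|t IHt] p.
  have -> : [set w | hist 0 w = p] = [set w | [:: (false, G 0 w)] = p].
    by [].
  apply: (@measurable_fiberP _ (G 0) [set g | [:: (false, g)] = p]).
  exact: measurable_graph.
case/lastP: p => [|p [b h]].
  rewrite (_ : [set _ | _] = set0) //; apply/seteqP; split => w //=.
have -> : [set w | hist t.+1 w = rcons p (b, h)] =
   [set w | hist t w = p] `&` [set w | Z t.+1 w = b] `&` [set w | G t.+1 w = h].
  apply/seteqP; split => w /=; rewrite histS; last by move=> [[-> ->] ->].
  by move=> /rcons_inj [-> -> ->].
apply: measurableI; last exact: measurable_graph.
by apply: measurableI; [exact: IHt|exact: measurable_Z].
Qed.

Lemma prob_in_seq (C : countType) (X : T -> C) (L : seq C) :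
  (forall c, measurable [set w | X w = c]) -> uniq L ->
  P [set w | X w \in L] = (\sum_(c <- L) P [set w | X w = c])%E.
Proof.
move=> mX; elim: L => [|c L IHL] /=.
  by move=> _; rewrite big_nil -(measure0 P); congr (P _); apply/seteqP; split.
move=> /andP[cL uL]; rewrite big_cons -IHL // -measureU //.
- congr (P _); apply/seteqP; split => w /=.
    by rewrite inE => /orP[/eqP|]; [left|right].
  by rewrite inE => -[->|->]; rewrite ?eqxx ?orbT.
- exact: (measurable_fiberP [set c | c \in L]).
- by apply/seteqP; split => w //= [->]; rewrite (negPf cL).
Qed.

Definition hprob t (p : history) : R := fine (P [set w | hist t w = p]).

Lemma hprobE t p : P [set w | hist t w = p] = (hprob t p)%:E.
Proof. by rewrite fineK // fin_num_measure //; exact: measurable_hist. Qed.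

Definition Z_prob (t : nat) (b : bool) : R := if b then f t.+1%:R else 1 - f t.+1%:R.

Lemma prob_Z t b : P (Z t.+1 @^-1` [set b]) = (Z_prob t b)%:E.
Proof.
have := step_bernoulli process t [set b]; rewrite /distribution /= /pushforward.
by move=> ->; rewrite /bernoulli_prob f01 fsbig_set1.
Qed.

Lemma hprob_rcons t p b h : size p = t.+1 -> (nth start p 0).1 = false ->
  hprob t.+1 (rcons p (b, h)) =
  hprob t p * Z_prob t b * transition b (last start p).2 h.
Proof.
move=> sz p0; rewrite /hprob.
have -> : [set w | hist t.+1 w = rcons p (b, h)] =
   [set w | hist t w = p] `&` Z t.+1 @^-1` [set b] `&` G t.+1 @^-1` [set h].
  apply/seteqP; split => w /=; rewrite histS; last by move=> [[-> ->] ->].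
  by move=> /rcons_inj [-> -> ->].
rewrite (hist_past sz p0) (graph_transition process) (step_independent_past process).
rewrite -(hist_past sz p0) hprobE prob_Z -!EFinM /= (last_nth start) sz //=.
Qed.

Definition hist_step t (phi : history -> R) (p : history) : R :=
  \sum_(b : bool) Z_prob t b *
     step_mean b (fun h => phi (rcons p (b, h))) (last start p).2.

Fixpoint hist_Ex t (phi : history -> R) : R :=
  if t is t'.+1 then hist_Ex t' (hist_step t' phi) else phi [:: start].

Lemma hist_Ex_last t (phi : multigraph -> R) :
  hist_Ex t (fun p => phi (last start p).2) = Ex f 0 t phi loop_graph.
Proof.
elim: t phi => [//|t IHt] phi /=; rewrite -IHt; congr hist_Ex; apply/funext => p.
rewrite /hist_step big_bool /= /step /=; congr (_ * _ + _ * _).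
  by apply: eq_bigr => u _; rewrite last_rcons.
by apply: eq_bigr => u _; apply: eq_bigr => v _; rewrite last_rcons.
Qed.

Definition successors (b : bool) g : seq multigraph :=
  if b then [seq add_vertex u | u <- enum 'I_(nverts g)]
  else [seq add_edge u v | u <- enum 'I_(nverts g), v <- enum 'I_(nverts g)].

(** The transition law is a combination of Dirac masses at the successors, so any duplicate-free
    list containing them can index the sum. *)
Lemma step_mean_support b (L : seq multigraph) (phi : multigraph -> R) g :
  uniq L -> {subset successors b g <= L} ->
  step_mean b phi g = \sum_(h <- L) transition b g h * phi h.
Proof.
move=> uL; have pick h : h \in L -> phi h = \sum_(h' <- L) (h' == h)%:R * phi h'.
  move=> hL; rewrite (bigD1_seq h) //= eqxx mul1r big1 ?addr0 // => h' /negPf ->.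
  by rewrite mul0r.
rewrite /step_mean /transition; case: b => sub.
  transitivity (\sum_(u < nverts g) \sum_(h <- L)
     (degree_dist u * (h == add_vertex u)%:R * phi h : R)).
    apply: eq_bigr => u _; rewrite pick; last first.
      by apply: sub; apply: map_f; rewrite mem_enum.
    by rewrite mulr_sumr; apply: eq_bigr => h _; rewrite mulrA.
  by rewrite exchange_big; apply: eq_bigr => h _; rewrite mulr_suml.
transitivity (\sum_(u < nverts g) \sum_(v < nverts g) \sum_(h <- L)
     (degree_dist u * degree_dist v * (h == add_edge u v)%:R * phi h : R)).
  apply: eq_bigr => u _; apply: eq_bigr => v _; rewrite pick; last first.
    by apply: sub; apply: allpairs_f; rewrite mem_enum.
  by rewrite mulr_sumr; apply: eq_bigr => h _; rewrite mulrA.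
under eq_bigr do rewrite exchange_big.
rewrite exchange_big; apply: eq_bigr => h _; rewrite mulr_suml.
by apply: eq_bigr => u _; rewrite mulr_suml.
Qed.

(** Finitely many graphs can follow a given one, so the law of the history is carried by a finite
    list, and expectations are finite sums. *)
Lemma hist_Ex_support t : exists L : seq history,
  [/\ uniq L, forall p, p \in L -> size p = t.+1 /\ (nth start p 0).1 = false &
   forall phi, hist_Ex t phi = \sum_(p <- L) hprob t p * phi p].
Proof.
elim: t => [|t [L [uL Lp EL]]].
  exists [:: [:: start]]; split => //; first by move=> p; rewrite inE => /eqP ->.
  move=> phi; rewrite big_seq1 /hprob /=.
  suff -> : P [set w | hist 0 w = [:: start]] = 1%E by rewrite mul1r.
  have -> : [set w | hist 0 w = [:: start]] = [set w | G 0 w = loop_graph].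
    apply/seteqP; split => w; rewrite /= -[hist 0 w]/[:: (false, G 0 w)].
      by move=> [].
    by move=> ->.
  have mS := measurable_graph 0 loop_graph.
  have := graph_start process.
  rewrite /almost_everywhere => /negligibleP H.
  have H0 : P (~` [set w | G 0 w = loop_graph]) = 0%E.
    by apply: H; exact: measurableC.
  rewrite -[X in P X]setCK probability_setC; last exact: measurableC.
  by rewrite [P _]H0 sube0.
(* One list serves all histories and both kinds of step: the graphs that cannot follow a given one
   have transition probability 0. *)
pose M := undup (flatten
  [seq successors b (last start p).2 | p <- L, b <- [:: true; false]]).
have subM p b : p \in L -> {subset successors b (last start p).2 <= M}.
  move=> pL h hs; rewrite mem_undup; apply/flattenP.
  exists (successors b (last start p).2) => //; apply/allpairsP.
  by exists (p, b); split => //; case: (b).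
pose L' := [seq rcons p bh |
  p <- L, bh <- [seq (b, h) | b <- [:: true; false], h <- M]].
exists L'; split.
- apply: allpairs_uniq => //; last by move=> [p x] [q y] _ _ /= /rcons_inj [-> ->].
  by apply: allpairs_uniq => //; [exact: undup_uniq|move=> [? ?] [? ?] _ _ /= [-> ->]].
- move=> q /allpairsP[[p bh] /= [/Lp[sz p0] _ ->]].
  by rewrite size_rcons sz; split => //; rewrite nth_rcons sz.
move=> phi /=; rewrite EL big_allpairs_dep; apply: eq_big_seq => p pL.
have [sz p0] := Lp _ pL.
rewrite big_allpairs_dep /hist_step big_bool big_cons big_seq1.
have aux b : hprob t p * (Z_prob t b *
    step_mean b (fun h => phi (rcons p (b, h))) (last start p).2) =
    \sum_(h <- M) hprob t.+1 (rcons p (b, h)) * phi (rcons p (b, h)).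
  rewrite (step_mean_support _ (undup_uniq _) (subM p b pL)) !mulr_sumr.
  by apply: eq_bigr => h _; rewrite hprob_rcons // !mulrA.
by rewrite mulrDr !aux.
Qed.

(** The histories outside the finite list have total probability 0, because those inside already sum
    to 1, by the case of the constant function 1. *)
Lemma prob_hist_le t (a : pred history) :
  (P [set w | a (hist t w)] <= (hist_Ex t (fun p => (a p)%:R))%:E)%E.
Proof.
have [L [uL Lp EL]] := hist_Ex_support t.
have tot : \sum_(p <- L) hprob t p = 1.
  transitivity (hist_Ex t (fun=> 1)).
    by rewrite EL; apply: eq_bigr => p _; rewrite mulr1.
  by rewrite (hist_Ex_last t (fun=> 1)) Ex_cst //; exact: reachable_loop.
have mS (s : pred history) : measurable [set w | s (hist t w)].
  exact: (measurable_fiberP [set p | s p]) (measurable_hist t).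
have PL (s : seq history) : uniq s ->
    P [set w | hist t w \in s] = (\sum_(p <- s) hprob t p)%:E.
  move=> us; rewrite prob_in_seq //; last exact: measurable_hist.
  by rewrite -sumEFin; apply: eq_bigr => p _; rewrite hprobE.
have PL0 : P [set w | hist t w \notin L] = 0%E.
  have -> : [set w | hist t w \notin L] = ~` [set w | hist t w \in L].
    by apply/seteqP; split => w /= /negP.
  by rewrite probability_setC ?PL ?tot ?subee //; exact: (mS (mem L)).
apply: (@le_trans _ _ (P ([set w | hist t w \notin L] `|`
    [set w | hist t w \in [seq p <- L | a p]]))).
  apply: le_measure; rewrite ?inE.
  - exact: mS.
  - by apply: measurableU; [exact: (mS [pred p | p \notin L])|
                            exact: (mS (mem [seq p <- L | a p]))].
  - move=> w /= aw; rewrite mem_filter aw /=.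
    by case: (boolP (hist t w \in L)); [right|left].
apply: (@le_trans _ _ (P [set w | hist t w \notin L] +
    P [set w | hist t w \in [seq p <- L | a p]])%E); first apply: measureU2.
- exact: (mS [pred p | p \notin L]).
- exact: (mS (mem [seq p <- L | a p])).
rewrite PL0 add0e PL ?filter_uniq // lee_fin EL big_filter big_mkcond /=.
by apply: ler_sum => p _; case: (a p); rewrite ?mulr1 ?mulr0.
Qed.

Lemma prob_graph_le t (a : pred multigraph) :
  (P [set w | a (G t w)] <= (Ex f 0 t (fun g => (a g)%:R) loop_graph)%:E)%E.
Proof.
rewrite -hist_Ex_last.
have := prob_hist_le t (fun p => a (last start p).2).
congr (P _ <= _)%E; apply/seteqP; split => w /=; by rewrite hist_last.
Qed.

End Law.

(** * Clique number *)

Section Cliques.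
Implicit Types (g : multigraph) (s : seq nat).
Local Open Scope nat_scope.

Definition clique_seq g s : Prop :=
  [/\ uniq s, {in s, forall v, v < nverts g} &
      {in s &, forall u v, u != v -> Defs.adjacent g u v}].

Lemma leq_clique_number g s : clique_seq g s -> size s <= clique_number g.
Proof.
move=> [us lts adjs]; pose S : {set 'I_(nverts g)} := finset (fun v => val v \in s).
have cS : is_clique S.
  apply/forall_inP => u; rewrite inE => su; apply/forall_inP => v; rewrite inE => sv.
  by apply/implyP => uv; apply: adjs.
have -> : size s = #|S|.
  rewrite cardE -(size_map val); apply/eqP; rewrite -uniq_size_uniq //.
    by rewrite map_inj_uniq ?enum_uniq //; exact: val_inj.
  move=> v; apply/mapP/idP => [[u]|sv]; first by rewrite mem_enum inE => + ->.
  by exists (Ordinal (lts _ sv)); rewrite // mem_enum inE.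
exact: (@leq_bigmax_cond _ (@is_clique g) (fun S : {set 'I_(nverts g)} => #|S|)).
Qed.

Lemma clique_number_seq g : exists2 s, clique_seq g s & size s = clique_number g.
Proof.
have c0 : is_clique (finset.set0 : {set 'I_(nverts g)}).
  by apply/forall_inP => u; rewrite inE.
have [S cS eqS] := @eq_bigmax_cond _ (fun S => is_clique S)
  (fun S : {set 'I_(nverts g)} => #|S|) (introT card_gt0P (ex_intro _ finset.set0 c0)).
exists [seq val v | v <- enum S]; last by rewrite size_map -cardE -eqS.
split; first by rewrite map_inj_uniq ?enum_uniq //; exact: val_inj.
  by move=> v /mapP[u _ ->]; exact: ltn_ord.
move=> x y /mapP[u + ->] /mapP[v + ->]; rewrite !mem_enum => uS vS uv.
exact: (implyP (forall_inP (forall_inP cS u uS) v vS)).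
Qed.

Lemma clique_number_sub g h : nverts g <= nverts h ->
  {subset edges g <= edges h} -> clique_number g <= clique_number h.
Proof.
move=> nv sub; have [s [us lts adjs] <-] := clique_number_seq g.
apply: leq_clique_number; split => // [v /lts vg|u v us' vs' uv].
  exact: leq_trans vg nv.
exact: sub (adjs _ _ us' vs' uv).
Qed.

Lemma clique_number_add_vertex g (u : 'I_(nverts g)) :
  clique_number g <= clique_number (add_vertex u).
Proof.
apply: clique_number_sub => [|e eg]; first by rewrite /nverts /=.
by rewrite /edges /= inE orbC -/(edges g) eg.
Qed.

Lemma clique_number_add_edge g (u v : 'I_(nverts g)) :
  clique_number g <= clique_number (add_edge u v).
Proof. by apply: clique_number_sub => // e eg; rewrite inE orbC eg. Qed.

Lemma clique_number_loop : 0 < clique_number loop_graph.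
Proof.
apply: (@leq_clique_number _ [:: 0]); split=> //.
  by move=> v; rewrite inE => /eqP ->.
by move=> u v; rewrite !inE => /eqP -> /eqP ->.
Qed.

Definition late_edges (n : nat) g : nat :=
  count (fun e : nat * nat => (n <= e.1) && (n <= e.2)) (edges g).

(** At most [n] clique vertices have a label below [n]. If [m] others remain, their [m ^ 2] ordered
    pairs are [m] diagonal ones and late edges in either orientation, whence
    [m ^ 2 <= m + 2 * late_edges n g]. *)
Lemma leq_clique_late n g : (clique_number g - n) ^ 2 <= 4 * late_edges n g + 1.
Proof.
have [s [us lts adjs] <-] := clique_number_seq g.
pose l := [seq v <- s | n <= v]; have ul : uniq l by exact: filter_uniq.
have szl : size s - n <= size l.
  rewrite leq_subLR -(count_predC (fun v => n <= v)) addnC size_filter leq_add2r.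
  rewrite -size_filter -[leqRHS](size_iota 0); apply: uniq_leq_size; first exact: filter_uniq.
  by move=> v; rewrite mem_filter mem_iota add0n /= -ltnNge => /andP[-> _].
pose L := [seq e <- edges g | (n <= e.1) && (n <= e.2)].
have : size [seq (u, v) | u <- l, v <- l] <=
    size ([seq (v, v) | v <- l] ++ L ++ [seq (e.2, e.1) | e <- L]).
  apply: uniq_leq_size; first by apply: allpairs_uniq => // -[? ?] [? ?].
  move=> e /allpairsP[[u v] [/=]]; rewrite !mem_filter => /andP[nu su] /andP[nv sv] ->.
  rewrite !mem_cat; have [->|uv] := eqVneq u v.
    by apply/orP; left; apply: map_f; rewrite mem_filter nv.
  have adj := adjs _ _ su sv uv; apply/orP; right; move: adj.
  rewrite /Defs.adjacent /upair; case: (ltngtP u v) => [ltuv|ltvu|/eqP]; last by rewrite (negPf uv).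
    by rewrite mem_filter /= nu nv /= => ->.
  move=> adj.
  by apply/orP; right; apply/mapP; exists (v, u) => //; rewrite mem_filter /= nu nv.
have szL : size L = late_edges n g by rewrite size_filter.
rewrite size_allpairs !size_cat !size_map szL => sq.
apply: (@leq_trans (size l ^ 2)); first by rewrite leq_exp2r.
rewrite -mulnn; move: (size l) sq => [|[|m]]; nia.
Qed.

End Cliques.

(** * Monotonicity of the clique number along the process *)

Section CliqueMono.
Context {R : realType} (f : R -> R) d (T : measurableType d)
  (P : probability T R) (Z : nat -> {RV P >-> bool}) (G : nat -> T -> multigraph).
Hypothesis f01 : forall t : nat, 0 <= f t.+1%:R <= 1.
Hypothesis process : edge_step_process f Z G.

(** Only the law of the process is known, so monotonicity holds almost surely. It compares two
    times, hence the use of histories and not just of the law of a single [G t]. *)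
Lemma ae_clique_number_nondecreasing : {ae P, forall w,
  (0 < clique_number (G 0 w))%N /\
  forall s t, (s <= t)%N -> (clique_number (G s w) <= clique_number (G t w))%N}.
Proof.
have step t : {ae P, forall w, (clique_number (G t w) <= clique_number (G t.+1 w))%N}.
  pose bad (p : seq (bool * multigraph)) :=
    ~~ (clique_number (nth (false, loop_graph) p t).2 <=
        clique_number (last (false, loop_graph) p).2)%N.
  have bad_eq : ~` [set w | (clique_number (G t w) <= clique_number (G t.+1 w))%N] =
      [set w | bad (hist Z G t.+1 w)].
    apply/seteqP; split => w /=; rewrite /bad hist_last /hist nth_mkseq //=.
      by move/negP.
    by move/negP.
  suff : P.-negligible [set w | bad (hist Z G t.+1 w)] by rewrite -bad_eq.
  apply/negligibleP.
    exact: (measurable_fiberP [set p | bad p]) (measurable_hist process t.+1).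
  apply/eqP; rewrite eq_le measure_ge0 andbT.
  apply: (le_trans (prob_hist_le f01 process t.+1 bad)).
  (* With the last step peeled off, a history of the support extended by a graph that a step can
     produce is never bad. *)
  have [L [uL Lp EL]] := hist_Ex_support f01 process t.
  rewrite lee_fin /= EL big_seq big1 // => p /Lp[sz _].
  rewrite /hist_step big_bool /=.
  have nbad b h : (clique_number (last (false, loop_graph) p).2 <= clique_number h)%N ->
      bad (rcons p (b, h)) = false.
    move=> le_h; rewrite /bad last_rcons nth_rcons sz ltnSn /=; apply/negbF.
    by rewrite (last_nth (false, loop_graph)) sz in le_h.
  rewrite [X in _ * X + _]big1 ?[X in _ + _ * X]big1 ?mulr0 ?addr0 ?mulr0 //.
    move=> u _; rewrite big1 // => v _.
    by rewrite nbad ?mulr0 //; exact: clique_number_add_edge.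
  by move=> u _; rewrite nbad ?mulr0 //; exact: clique_number_add_vertex.
have := ae_foralln step; have := graph_start process; apply: filterS2 => w G0 mono.
split; first by rewrite G0 clique_number_loop.
move=> s; elim=> [|t IHt]; first by rewrite leqn0 => /eqP ->.
by rewrite leq_eqVlt ltnS => /predU1P[-> //|/IHt/leq_trans]; apply.
Qed.

End CliqueMono.

(** * Edges between late vertices *)

Section StepFormulas.
Context {R : realType}.
Implicit Types (g : multigraph) (p : R).

Lemma step_nverts p t g : reachable t g ->
  step p (fun h => (nverts h)%:R) g = (nverts g)%:R + p.
Proof.
move=> rg; have nvS u : nverts (@add_vertex g u) = (nverts g).+1 by [].
rewrite (@step_affine _ p predT t g _ (nverts g).+1%:R 0 (nverts g)%:R 0 0 rg).
- by rewrite -natr1; ring.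
- by move=> u; rewrite nvS; ring.
- by move=> u v; rewrite /nverts /=; ring.
Qed.

(** Exponential moment for the lower tail of the number of vertices: a vertex-step halves it, an
    edge-step leaves it unchanged. *)
Lemma step_half_nverts p t g : reachable t g ->
  step p (fun h => 2^-1 ^+ nverts h) g = (1 - p / 2) * 2^-1 ^+ nverts g.
Proof.
move=> rg; have nvS u : nverts (@add_vertex g u) = (nverts g).+1 by [].
rewrite (@step_affine _ p predT t g _ (2^-1 * 2^-1 ^+ nverts g) 0 (2^-1 ^+ nverts g) 0 0 rg).
- by field.
- by move=> u; rewrite nvS exprS; ring.
- by move=> u v; rewrite /nverts /=; ring.
Qed.

Definition late_deg n g : R := (total_deg (leq n) g)%:R.

Lemma late_deg_add_vertex n g (u : 'I_(nverts g)) : (n <= nverts g)%N ->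
  late_deg n (add_vertex u) = late_deg n g + 1 + (n <= u)%N%:R.
Proof. by move=> ng; rewrite /late_deg total_deg_add_vertex ng !natrD /=; ring. Qed.

Lemma late_deg_add_edge n g (u v : 'I_(nverts g)) :
  late_deg n (add_edge u v) = late_deg n g + ((n <= u)%N%:R + (n <= v)%N%:R).
Proof. by rewrite /late_deg total_deg_add_edge !natrD; ring. Qed.

Lemma late_edges_add_vertex n g (u : 'I_(nverts g)) : (n <= nverts g)%N ->
  late_edges n (add_vertex u) = (late_edges n g + (n <= u))%N.
Proof.
move=> ng; rewrite /late_edges /= [RHS]addnC; congr (nat_of_bool _ + _)%N.
by rewrite leq_min leq_max ng orbT !andbT.
Qed.

Lemma late_edges_add_edge n g (u v : 'I_(nverts g)) :
  late_edges n (add_edge u v) = (late_edges n g + ((n <= u) && (n <= v)))%N.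
Proof.
rewrite /late_edges /= [RHS]addnC; congr (nat_of_bool _ + _)%N.
by rewrite leq_min leq_max; case: (n <= u)%N; case: (n <= v)%N.
Qed.

Lemma total_deg_le a t g : reachable t g -> (total_deg a g <= 2 * t.+1)%N.
Proof.
move=> [sz _ _]; rewrite -sz mul2n -total_degT /total_deg.
by apply: leq_sum => e _; case: (a e.1); case: (a e.2).
Qed.

Lemma mass_le1 a t g : reachable t g ->
  0 <= (total_deg a g)%:R / (2 * t.+1%:R : R) <= 1.
Proof.
move=> rg; rewrite divr_ge0 //= ler_pdivrMr ?mul1r ?mulr_gt0 //.
by rewrite -natrM ler_nat total_deg_le.
Qed.

(** Let [m = L / (2 * a)] be the chance that a drawn end is late. The number of late edges grows by
    at most [m ^+ 2] through edge-steps and [p * m] through vertex-steps, in mean; the other terms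
    come from the growth of [L]. The slack is a sum of nonnegative terms because [p] and [m] lie in
    [0, 1]. *)
Lemma step_late_potential p t g n (al be L a : R) :
  L = late_deg n g -> a = t.+1%:R -> reachable t g -> (n <= nverts g)%N ->
  0 <= al -> 0 <= be -> 0 <= p <= 1 ->
  step p (fun h => (late_edges n h)%:R + al * late_deg n h ^+ 2 + be * late_deg n h) g <=
  (late_edges n g)%:R +
  (L ^+ 2 * ((4 * a ^+ 2)^-1 + al * (1 + 2 / a)) +
   L * (p / (2 * a) + al * (2 / a + 2 * p) + be * (1 + a^-1)) +
   p * (4 * al + be)).
Proof.
move=> LE aE rg ng al0 be0 /andP[p0 p1].
rewrite (@step_affine _ p (leq n) t g _
  ((late_edges n g)%:R + al * (L + 1) ^+ 2 + be * (L + 1))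
  (1 + al * (2 * L + 3) + be)
  ((late_edges n g)%:R + al * L ^+ 2 + be * L)
  (al * (2 * L + 1) + be)
  (1 + 2 * al) rg); first last.
- move=> u v; rewrite late_edges_add_edge late_deg_add_edge -LE natrD.
  by case: (n <= u)%N; case: (n <= v)%N; rewrite /=; ring.
- move=> u; rewrite late_edges_add_vertex // late_deg_add_vertex // -LE natrD.
  by case: (n <= u)%N; rewrite /=; ring.
have := mass_le1 (leq n) rg; rewrite -aE; set m := _ / _ => /andP[m0 m1].
have a0 : 0 < a by rewrite aE ltr0n.
have Lm : L = 2 * a * m by rewrite /m LE /late_deg; field; rewrite gt_eqF.
have L0 : 0 <= L by rewrite LE ler0n.
rewrite (_ : (4 * a ^+ 2)^-1 = (2 * a)^-1 ^+ 2); last by field; rewrite gt_eqF.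
have Hm : L / (2 * a) = m by rewrite Lm; field; rewrite gt_eqF.
have -> : L ^+ 2 * ((2 * a)^-1 ^+ 2 + al * (1 + 2 / a)) +
   L * (p / (2 * a) + al * (2 / a + 2 * p) + be * (1 + a^-1)) +
   p * (4 * al + be) = m ^+ 2 + al * (L ^+ 2 + 4 * L * m) +
   (p * m + al * (4 * m + 2 * p * L) + be * (L + 2 * m)) + p * (4 * al + be).
  by rewrite -Hm; field; rewrite gt_eqF.
rewrite -subr_ge0; set D := (X in 0 <= X).
have -> : D = p * m ^+ 2 + be * p * m +
    al * (p * (2 * L * m + m + 3) + 2 * (1 - p) * m * (1 - m)) by rewrite /D; ring.
have [? ?] : 0 <= 1 - p /\ 0 <= 1 - m by rewrite !subr_ge0.
do ?[done | apply: addr_ge0 | apply: mulr_ge0 | exact: sqr_ge0].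
Qed.

End StepFormulas.

Section Bounds.
Context {R : realType} (f : R -> R).
Hypothesis f01 : forall t : nat, 0 <= f t.+1%:R <= 1.
Implicit Types (g : multigraph).

Lemma Ex_nverts s : Ex f 0 s (fun h => (nverts h)%:R) loop_graph <=
  1 + \sum_(i < s) f i.+1%:R.
Proof.
have := @Ex_supermartingale _ f f01 _ stable_reachable 0 s
  (fun i h => (nverts h)%:R + - \sum_(j < i) f j.+1%:R) loop_graph.
rewrite ExD Ex_cst //; last exact: reachable_loop.
rewrite big_ord0 subr0 lerBlDr; apply; last exact: reachable_loop.
move=> i h _ rh; rewrite stepD (step_nverts _ rh) (step_cst _ _ rh).
by rewrite add0n big_ord_recr /= opprD addrACA subrr addr0.
Qed.

Definition reachable_above n (t : nat) g := reachable t g /\ (n <= nverts g)%N.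

Lemma stable_above n : stable (reachable_above n).
Proof.
move=> t g [rg ng]; have [rv re] := stable_reachable rg.
by split=> *; split => //; apply: leqW.
Qed.

Lemma late_edges0 g : late_edges (nverts g) g = 0%N.
Proof.
rewrite /late_edges; apply/eqP; rewrite -leqn0 leqNgt -has_count.
by apply/hasPn => e /edge_bound /andP[_]; rewrite negb_and -!ltnNge orbC => ->.
Qed.

Lemma late_deg0 g : late_deg (nverts g) g = 0 :> R.
Proof.
rewrite /late_deg /total_deg big_seq big1 // => e /edge_bound /andP[le_e lt_e].
by rewrite (ltn_geF lt_e) (ltn_geF (leq_ltn_trans le_e lt_e)).
Qed.

(** Backward recursion for the coefficients of the potential: primes refer to the next time, [a] is
    the number of edges and [r] the number of steps left after this one. [al] satisfies its
    recursion exactly with source [1 / (2 * a * (a + 1))], which dominates the true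
    [1 / (4 * a ^+ 2)] when [1 <= a]. The last summand is the constant cost of the step. *)
Lemma late_potential_coef (al al' be be' y y' p p1 L a k r : R) :
  1 <= a -> 0 <= p <= p1 -> 0 <= L -> 0 <= r -> r + 1 <= k ->
  al = (r + 1) / (2 * a * (a + 1)) -> al' = r / (2 * (a + 1) * (a + 2)) ->
  be = y / a -> be' = y' / (a + 1) -> 0 <= y' ->
  y = y' + p1 / 2 + k * ((a + 1)^-1 - (a + 2)^-1) + k * p1 / (a + 1) ->
  L ^+ 2 * ((4 * a ^+ 2)^-1 + al' * (1 + 2 / a)) +
   L * (p / (2 * a) + al' * (2 / a + 2 * p) + be' * (1 + a^-1)) +
   p * (4 * al' + be') <=
  al * L ^+ 2 + be * L +
  (2 * k * p1 * ((a + 1)^-1 - (a + 2)^-1) + p1 * y' / (a + 1)).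
Proof.
move=> a1 /andP[p0 pp] L0 r0 rk alE alE' beE beE' y0 yE.
have a0 : 0 < a by lra.
have a10 : 0 < a + 1 by lra.
have a20 : 0 < a + 2 by lra.
have [nz0 nz1 nz2] : [/\ a != 0, a + 1 != 0 & a + 2 != 0] by rewrite !gt_eqF.
have al'0 : 0 <= al' by rewrite alE' divr_ge0 // !mulr_ge0 // ltW.
have al'k : al' <= k / (2 * (a + 1) * (a + 2)).
  by rewrite alE' ler_pM2r ?invr_gt0 ?mulr_gt0 //; lra.
have dE : (a + 1)^-1 - (a + 2)^-1 = ((a + 1) * (a + 2))^-1 by field; rewrite nz1 nz2.
have inv0 : 0 < ((a + 1) * (a + 2))^-1 by rewrite invr_gt0 mulr_gt0.
have be'0 : 0 <= be' by rewrite beE' divr_ge0 // ltW.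
apply: lerD; first apply: lerD.
- rewrite mulrC; apply: ler_wpM2r; first exact: sqr_ge0.
  have -> : al = (2 * a * (a + 1))^-1 + al' * (1 + 2 / a).
    by rewrite alE alE'; field; rewrite nz0 nz1 nz2.
  rewrite lerD2r lef_pV2 ?posrE ?mulr_gt0 ?exprn_gt0 //; nra.
- rewrite mulrC; apply: ler_wpM2r => //.
  have -> : be = p1 / (2 * a) + (k / (2 * (a + 1) * (a + 2))) * (2 / a) +
     k * p1 / (a * (a + 1)) + be' * (1 + a^-1).
    by rewrite beE yE beE'; field; rewrite nz0 nz1 nz2.
  rewrite lerD2r mulrDr addrA; apply: lerD; first apply: lerD.
  + by rewrite ler_pM2r // invr_gt0 mulr_gt0.
  + by apply: ler_wpM2r => //; rewrite divr_ge0 // ltW.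
  + apply: (@le_trans _ _ (k / (2 * (a + 1) * (a + 2)) * (2 * p1))).
      by apply: ler_pM => //; [lra|rewrite ler_pM2l].
    have -> : k / (2 * (a + 1) * (a + 2)) * (2 * p1) =
       k * p1 * ((a + 1) * (a + 2))^-1 by field; rewrite nz1 nz2.
    apply: ler_wpM2l; first by rewrite mulr_ge0 //; lra.
    by rewrite lef_pV2 ?posrE ?mulr_gt0 //; nra.
- rewrite mulrDr; apply: lerD.
    rewrite dE; apply: (@le_trans _ _ (p1 * (4 * (k / (2 * (a + 1) * (a + 2)))))).
      by apply: ler_pM; rewrite ?mulr_ge0 // ler_pM2l.
    by rewrite le_eqVlt; apply/orP; left; apply/eqP; field; rewrite nz1 nz2.
  by rewrite beE' -mulrA ler_wpM2r // divr_ge0 // ltW.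
Qed.

(* With e the number of late edges and L the late degree, the supermartingale is
   e + al L^2 + (y / a) L + dl, whose coefficients bound the future edges due to
   each term: k - i steps are left at time i, and p dominates both f and the
   inverse of the starting time. *)
Lemma Ex_late_edges s k g (p h : R) : reachable s g ->
  (forall i, (i < k)%N -> f (s + i).+1%:R <= p) -> s.+2%:R^-1 <= p ->
  \sum_(0 <= i < k) (s + i).+2%:R^-1 <= h ->
  Ex f s k (fun x => (late_edges (nverts g) x)%:R) g <= k%:R * p ^+ 2 * (h + 2) ^+ 2.
Proof.
move=> rg fp sp Hh; set n := nverts g.
have p0 : 0 < p by rewrite (lt_le_trans _ sp) // invr_gt0 ltr0n.
pose H i : R := \sum_(i <= j < k) (s + j).+2%:R^-1.
have H0 i : 0 <= H i by apply: sumr_ge0 => j _; rewrite invr_ge0.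
have HS i : (i < k)%N -> H i = (s + i).+2%:R^-1 + H i.+1.
  by move=> ik; rewrite /H big_ltn.
pose a i : R := (s + i).+1%:R.
have a1 i : 1 <= a i by rewrite ler1n.
have aS i : a i.+1 = a i + 1 by rewrite /a addnS natr1.
have a2 i : (s + i).+2%:R = a i + 1 by rewrite /a natr1.
(* The three terms pay, in this order, for the vertex-steps attached to late vertices, for the terms
   in [2 / a] from the growth of the square, whose sum telescopes, and for its terms in [2 * p],
   which add up to a harmonic sum. *)
pose y i : R := p * (k%:R - i%:R) / 2 + k%:R / (a i + 1) + k%:R * p * H i.
pose Y := k%:R * p * (h + 2).
have Hle i : (i <= k)%N -> H i <= h.
  move=> ik; apply: le_trans Hh; rewrite [leRHS](big_cat_nat (n := i)) //= lerDr.
  by apply: sumr_ge0 => j _; rewrite invr_ge0.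
have h0 : 0 <= h := le_trans (H0 0%N) (Hle 0%N (leq0n k)).
have a_inv i : (a i + 1)^-1 <= p.
  by apply: le_trans sp; rewrite -a2 lef_pV2 ?posrE // ler_nat !ltnS leq_addr.
have a0 i : 0 < a i by rewrite (lt_le_trans ltr01).
have yY i : (i <= k)%N -> 0 <= y i <= Y.
  move=> ik; have ki : 0 <= k%:R - i%:R :> R by rewrite subr_ge0 ler_nat.
  apply/andP; split; rewrite /y.
    rewrite !addr_ge0 // ?divr_ge0 ?mulr_ge0 // ?ltW //.
    by rewrite -a2.
  have -> : Y = p * k%:R / 2 + k%:R * p + k%:R * p * h + p * k%:R / 2 by rewrite /Y; field.
  have kp : 0 <= k%:R * p by rewrite mulr_ge0 // ltW.
  apply: (@le_trans _ _ (p * k%:R / 2 + k%:R * p + k%:R * p * h)); last first.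
    by rewrite lerDl divr_ge0 // mulrC.
  apply: lerD; first apply: lerD.
  - by rewrite ler_pM2r ?invr_gt0 // ler_pM2l // gerBl.
  - exact: ler_wpM2l.
  - by apply: ler_wpM2l => //; exact: Hle.
pose al i : R := (k%:R - i%:R) / (2 * a i * (a i + 1)).
(* A vertex-step brings late degree even when [L] is 0. Its cost through the square telescopes into
   the first term; its cost through the linear term is summed after bounding [y] by [Y]. *)
pose dl i : R := 2 * k%:R * p / (a i + 1) + p * Y * H i.
have al0 i : (i <= k)%N -> 0 <= al i.
  move=> ik; rewrite /al divr_ge0 ?subr_ge0 ?ler_nat // !mulr_ge0 ?addr_ge0 // ltW //.
have Y0 : 0 <= Y by have /andP[/le_trans] := yY 0%N (leq0n k); apply.
have dl0 i : 0 <= dl i.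
  have p0' := ltW p0; apply: addr_ge0; last exact: mulr_ge0 (mulr_ge0 p0' Y0) (H0 i).
  by rewrite divr_ge0 ?mulr_ge0 // -a2.
pose phi i x : R := ((late_edges n x)%:R + al i * late_deg n x ^+ 2 +
  y i / a i * late_deg n x) + dl i.
have phi0 : phi 0%N g <= k%:R * p ^+ 2 * (h + 2) ^+ 2.
  rewrite /phi late_edges0 late_deg0 expr0n /= !mulr0 !add0r /dl.
  have -> : k%:R * p ^+ 2 * (h + 2) ^+ 2 =
      2 * k%:R * p * p + p * Y * h + k%:R * p ^+ 2 * (2 * h + 2).
    by rewrite /Y; ring.
  apply: ler_wpDr; first by apply: mulr_ge0; [exact: mulr_ge0 (ler0n _ _) (sqr_ge0 _)|lra].
  have p0' := ltW p0; apply: lerD; first by apply: ler_wpM2l => //; rewrite !mulr_ge0.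
  by apply: ler_wpM2l; [exact: mulr_ge0|exact: Hle].
apply: le_trans phi0.
apply: (@le_trans _ _ (Ex f s k (phi k) g)).
  apply: (ler_Ex f01 stable_reachable) => // x _; rewrite /phi -!addrA lerDl.
  have /andP[yk0 _] := yY k (leqnn k); have yk := divr_ge0 yk0 (ltW (a0 k)).
  apply: addr_ge0; first exact: mulr_ge0 (al0 _ (leqnn k)) (sqr_ge0 _).
  by apply: addr_ge0 => //; exact: mulr_ge0 yk (ler0n _ _).
apply: (@Ex_supermartingale _ f f01 _ (@stable_above n) s k phi); last by split.
move=> i x ik [rx nx]; have ik' := ltnW ik.
have [/andP[yi0 yiY] /andP[yS0 ySY]] := (yY _ ik', yY _ ik).
have fi : 0 <= f (s + i).+1%:R <= p by rewrite fp // andbT; case/andP: (f01 (s + i)).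
rewrite /phi stepD (step_cst _ _ rx).
have be0 := divr_ge0 yS0 (ltW (a0 i.+1)).
have hstep :=
  step_late_potential erefl (erefl (a i)) rx nx (al0 _ ik) be0 (f01 (s + i)).
apply: (le_trans (lerD hstep (lexx _))).
have L0 : 0 <= late_deg n x :> R by rewrite ler0n.
have r0 : 0 <= k%:R - i.+1%:R :> R by rewrite subr_ge0 ler_nat.
have rk : k%:R - i.+1%:R + 1 <= k%:R :> R by have := ler0n R i; rewrite -natr1; lra.
have a12 : a i + 1 + 1 = a i + 2 by ring.
have alE : al i = (k%:R - i.+1%:R + 1) / (2 * a i * (a i + 1)).
  by rewrite /al; congr (_ / _); rewrite -natr1; ring.
have alE' : al i.+1 = (k%:R - i.+1%:R) / (2 * (a i + 1) * (a i + 2)).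
  by rewrite /al aS a12.
have beE : y i.+1 / a i.+1 = y i.+1 / (a i + 1) by rewrite aS.
have yiE : y i = y i.+1 + p / 2 + k%:R * ((a i + 1)^-1 - (a i + 2)^-1) + k%:R * p / (a i + 1).
  rewrite /y (HS _ ik) aS a2 a12 -natr1; have := a0 i; move: (a i) => b b0.
  by field; rewrite !gt_eqF // ?addr_gt0.
have hM := late_potential_coef (a1 i) fi L0 r0 rk alE alE' erefl beE yS0 yiE.
have : p * y i.+1 / (a i + 1) <= p * Y / (a i + 1).
  by rewrite ler_pM2r ?invr_gt0 ?addr_gt0 // ler_pM2l.
have : dl i = 2 * k%:R * p * ((a i + 1)^-1 - (a i + 2)^-1) + p * Y / (a i + 1) + dl i.+1.
  rewrite /dl (HS _ ik) aS a2 a12; have := a0 i; move: (a i) => b b0.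
  by field; rewrite !gt_eqF // ?addr_gt0.
move=> -> hY; apply: (le_trans (lerD (lerD (lexx _) hM) (lexx _))).
rewrite -!addrA !lerD2l lerD2r.
exact: hY.
Qed.

End Bounds.

(** * Degrees of early vertices *)

Section LowerSteps.
Context {R : realType}.
Implicit Types (g : multigraph) (p c : R).

(* The decay rate is nearly 1 / (2 - c), which is as close to 1 as needed when c
   tends to 1; the plain inverse degree (c = 0) would only decay at rate 1/2,
   because of vertices of degree 1. *)
Lemma step_inv_deg p c t g v : reachable t g -> (v < nverts g)%N ->
  0 < c < 1 -> 0 <= p <= 1 ->
  step p (fun h => ((deg h v)%:R - c)^-1) g <=
  (1 - (1 - p) * (1 - (2 * t.+1%:R)^-1) / (2 - c) / t.+1%:R) * ((deg g v)%:R - c)^-1.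
Proof.
move=> rg vg /andP[c0 c1] /andP[p0 p1]; set a : R := t.+1%:R.
have a1 : 1 <= a by rewrite ler1n.
pose D : R := (deg g v)%:R.
have D1 : 1 <= D by rewrite ler1n; case: rg => _ _; apply.
have := mass_le1 (R := R) (pred1 v) rg; rewrite -/(deg g v) -/D -/a => /andP[_ m1].
rewrite (@step_affine _ p (pred1 v) t g _
  (D - c)^-1 ((D + 1 - c)^-1 - (D - c)^-1)
  (D - c)^-1 ((D + 1 - c)^-1 - (D - c)^-1)
  ((D + 2 - c)^-1 - 2 * (D + 1 - c)^-1 + (D - c)^-1) rg); first last.
- have eD : (1 + 1 + D = D + 2) * (1 + 0 + D = D + 1) * (0 + 1 + D = D + 1) *
    (0 + 0 + D = D) by do !split; ring.
  move=> x y; rewrite deg_add_edge !natrD -/D /=.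
  by case: (_ == v); case: (_ == v); rewrite /= ?mulr0n ?mulr1n eD; ring.
- move=> x; rewrite deg_add_vertex !natrD -/D /= (gtn_eqF vg) /= addr0.
  by case: (_ == v); rewrite /= ?mulr0n ?mulr1n ?add0r ?(addrC 1 D); ring.
rewrite -/(deg g v) -/D -/a; clearbody a D; set m := D / (2 * a).
have m0 : 0 <= m by rewrite divr_ge0 //; lra.
have [nz0 nz1 nz2] : [/\ D - c != 0, D + 1 - c != 0 & D + 2 - c != 0].
  by split; rewrite gt_eqF //; lra.
have g0 : 0 < (D - c)^-1 by rewrite invr_gt0; lra.
(* This separates the decrease due to vertex-steps, dropped in [h1], from that due to edge-steps,
   which dominates when [p] is small. *)
have -> : p * ((D - c)^-1 + ((D + 1 - c)^-1 - (D - c)^-1) * m) +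
  (1 - p) * ((D - c)^-1 + ((D + 1 - c)^-1 - (D - c)^-1) * (2 * m) +
  ((D + 2 - c)^-1 - 2 * (D + 1 - c)^-1 + (D - c)^-1) * m ^+ 2) =
  (1 - p * (m / (D + 1 - c)) -
   (1 - p) * ((2 * m) / (D + 1 - c) * (1 - m / (D + 2 - c)))) * (D - c)^-1.
  by field; rewrite nz0 nz1 nz2.
rewrite ler_pM2r //.
have h1 : 0 <= p * (m / (D + 1 - c)) by rewrite mulr_ge0 // divr_ge0 //; lra.
have a0 : 0 < a by lra.
have az : a != 0 by rewrite gt_eqF.
(* [D / (D + 1 - c)] increases with [D], so the worst case is degree 1, which gives
   [1 / (2 - c)]. *)
have h2 : (2 - c)^-1 / a <= (2 * m) / (D + 1 - c).
  have -> : 2 * m / (D + 1 - c) = (D / (D + 1 - c)) / a by rewrite /m; field; rewrite az nz1.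
  have Dc : 0 < D + 1 - c by lra.
  have c2 : 0 < 2 - c by lra.
  have c1' : 0 <= 1 - c by lra.
  rewrite ler_pM2r ?invr_gt0 // ler_pdivlMr // mulrC ler_pdivrMr //.
  by have := ler_wpM2r c1' D1; lra.
have h3 : 1 - (2 * a)^-1 <= 1 - m / (D + 2 - c).
  rewrite lerD2l lerN2 ler_pdivrMr; last by lra.
  rewrite /m mulrC ler_pM2l ?invr_gt0; last by lra.
  lra.
have h4 : 0 <= 1 - (2 * a)^-1.
  by rewrite subr_ge0 invf_le1; lra.
have h5 : 0 <= (2 - c)^-1 / a by rewrite divr_ge0 // ?invr_ge0; lra.
have : (2 - c)^-1 / a * (1 - (2 * a)^-1) <= 2 * m / (D + 1 - c) * (1 - m / (D + 2 - c)).
  exact: ler_pM.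
have p1' : 0 <= 1 - p by lra.
move/(ler_wpM2l p1').
rewrite (_ : (1 - p) * (1 - (2 * a)^-1) / (2 - c) / a =
  (1 - p) * ((2 - c)^-1 / a * (1 - (2 * a)^-1))); last by ring.
move: ((1 - p) * _) ((1 - p) * _) (p * _) h1 => X Y W h1; lra.
Qed.

Definition nonadjacent u v g : R := (~~ Defs.adjacent g u v)%:R.

(** An edge-step draws [u] first and [v] second with probability at least the square of [K] over the
    total degree, and an adjacency is never lost. *)
Lemma step_nonadjacent p t g u v (K : R) : reachable t g ->
  (u < nverts g)%N -> (v < nverts g)%N -> 0 <= p <= 1 -> 0 <= K ->
  K <= (deg g u)%:R -> K <= (deg g v)%:R ->
  step p (nonadjacent u v) g <=
  (1 - (1 - p) * (K / (2 * t.+1%:R)) ^+ 2) * nonadjacent u v g.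
Proof.
move=> rg ug vg p01 K0 Ku Kv; have [p0 p1] := andP p01.
rewrite /nonadjacent; have [adj|nadj] := boolP (Defs.adjacent g u v); rewrite ?mulr0 ?mulr1 /=.
  rewrite -[leRHS](step_cst p 0 rg); apply: ler_step => //.
    by move=> x; rewrite /Defs.adjacent inE -[upair u v \in _]/(Defs.adjacent g u v) adj orbT.
  by move=> x y; rewrite /Defs.adjacent inE -[upair u v \in _]/(Defs.adjacent g u v) adj orbT.
have sum1 := sum_degree_dist1 (R := R) rg.
have totE : (\sum_(w < nverts g) deg g w = 2 * t.+1)%N.
  by case: rg => <- _ _; rewrite mul2n -total_degT total_degE.
have ddK w : K <= (deg g (w : 'I_(nverts g)))%:R -> K / (2 * t.+1%:R) <= degree_dist w.
  by move=> Kw; rewrite /degree_dist totE natrM ler_pM2r // invr_gt0 mulr_gt0.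
pose x0 := Ordinal ug; pose y0 := Ordinal vg.
have hv : step_mean true (fun h => (~~ Defs.adjacent h u v)%:R) g <= 1 :> R.
  rewrite -[leRHS]sum1 /step_mean; apply: ler_sum => x _.
  apply: ler_piMr; first exact: degree_dist_ge0.
  by rewrite lern1 leq_b1.
have he : step_mean false (fun h => (~~ Defs.adjacent h u v)%:R) g <=
    1 - (K / (2 * t.+1%:R)) ^+ 2 :> R.
  apply: (@le_trans _ _ (1 - degree_dist x0 * degree_dist y0)); last first.
    rewrite lerD2l lerN2 expr2; apply: ler_pM; rewrite ?divr_ge0 ?mulr_ge0 //.
      exact: ddK.
    exact: ddK.
  rewrite lerBrDr; set A := (X in _ + X).
  have -> : A = \sum_(x < nverts g) \sum_(y < nverts g)
     degree_dist x * degree_dist y * ((x == x0) && (y == y0))%:R.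
    rewrite (bigD1 x0) //= (bigD1 y0) //= !eqxx mulr1 !big1 ?addr0 //.
      by move=> x /negPf ->; rewrite big1 // => y _; rewrite mulr0.
    by move=> y /negPf ->; rewrite mulr0.
  rewrite [leRHS](_ : 1 = \sum_(x < nverts g) \sum_(y < nverts g)
      degree_dist x * degree_dist y); last first.
    by rewrite -[LHS]sum1; apply: eq_bigr => x _; rewrite -mulr_sumr sum1 mulr1.
  rewrite /step_mean -big_split; apply: ler_sum => x _.
  rewrite -big_split; apply: ler_sum => y _ /=.
  rewrite -mulrDr; apply: ler_piMr; first by rewrite mulr_ge0 ?degree_dist_ge0.
  case: andP => [[/eqP -> /eqP ->]|_]; last by rewrite addr0 lern1 leq_b1.
  by rewrite /Defs.adjacent inE eqxx add0r.
have p1' : 0 <= 1 - p by rewrite subr_ge0.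
apply: (le_trans (lerD (ler_wpM2l p0 hv) (ler_wpM2l p1' he))).
by rewrite le_eqVlt; apply/orP; left; apply/eqP; ring.
Qed.

End LowerSteps.

Lemma ler_bool (R : numDomainType) (b c : bool) : (b -> c) -> b%:R <= c%:R :> R.
Proof. by rewrite ler_nat; case: b => // ->. Qed.

(** * Lower tail of the clique number at a fixed time *)

Section LowerTail.
Context {R : realType} (f : R -> R).
Hypothesis f01 : forall t : nat, 0 <= f t.+1%:R <= 1.
Implicit Types (g h : multigraph).

(** Chernoff bound: [2^-1 ^+ nverts h] has mean at most [expR (- (F / 2))], while on the event it is
    at least [expR (- (F / 4))], as [expR (-1) <= 2^-1]. The remaining [expR (- (F / 4))] is
    weakened to [4 / F], which is enough when [F] grows geometrically. *)
Lemma Ex_few_nverts s (F : R) : 0 < F -> F <= \sum_(i < s) f i.+1%:R ->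
  Ex f 0 s (fun h => ((nverts h)%:R < F / 4)%R%:R) loop_graph <= 4 / F.
Proof.
move=> F0 leF.
have half_e : expR (-1) <= 2^-1 :> R.
  by rewrite expRN lef_pV2 ?posrE ?expR_gt0 // (le_trans _ (expR_ge1Dx _)).
apply: (@le_trans _ _ (Ex f 0 s (fun h => expR (F / 4) * 2^-1 ^+ nverts h) loop_graph)).
  apply: (ler_Ex f01 stable_reachable) => [h _|]; last exact: reachable_loop.
  have [Vlt|_] := ltP; last by rewrite mulr_ge0 ?expR_ge0 ?exprn_ge0.
  apply: (@le_trans _ _ (expR (F / 4) * expR (-1) ^+ nverts h)).
    by rewrite -expRM_natr mulN1r -expRD -[leLHS]expR0 ler_expR subr_ge0 ltW.
  by rewrite ler_wpM2l ?expR_ge0 // lerXn2r ?nnegrE ?expR_ge0.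
rewrite ExZ.
have := @Ex_prod _ f f01 _ stable_reachable 0 s (fun i => 1 - f i.+1%:R / 2)
  (fun h => 2^-1 ^+ nverts h) loop_graph.
rewrite expr1 => /(_ _ _ reachable_loop) Hp.
have {Hp} Hp : Ex f 0 s (fun h => 2^-1 ^+ nverts h) loop_graph <= expR (- (F / 2)).
  apply: (le_trans (Hp _ _)).
  - by move=> i _; have := f01 i; lra.
  - by move=> i h _ rh; rewrite (step_half_nverts _ rh).
  apply: (@le_trans _ _ (\prod_(i < s) (1 - f i.+1%:R / 2))).
    rewrite ler_piMr //; last by lra.
    by apply: prodr_ge0 => i _; have := f01 i; lra.
  apply: (@le_trans _ _ (\prod_(i < s) expR (- (f i.+1%:R / 2)))).
    by apply: ler_prod => i _; rewrite expR_ge1Dx andbT; have := f01 i; lra.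
  by rewrite -expR_sum ler_expR sumrN lerN2 -mulr_suml ler_pM2r.
apply: (le_trans (ler_wpM2l (expR_ge0 _) Hp)).
rewrite -expRD (_ : F / 4 + - (F / 2) = - (F / 4)); last by field.
rewrite expRN -[leRHS]invf_div lef_pV2 ?posrE ?expR_gt0 ?divr_gt0 //.
by rewrite (le_trans _ (expR_ge1Dx _)) // lerDr.
Qed.

Definition inv_deg_sum (c : R) n g : R := \sum_(v <- iota 0 n) ((deg g v)%:R - c)^-1.

(** Telescoping of logarithms, with [ln (1 + x) <= x] at each term; the next lemma uses the same
    inequality at a negative [x]. *)
Lemma harmonic_ge s k :
  ln ((s + k).+1%:R / s.+1%:R) <= \sum_(i < k) (s + i).+1%:R^-1 :> R.
Proof.
elim: k => [|k IHk]; first by rewrite addn0 divff // ln1 big_ord0.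
rewrite big_ord_recr /=.
have -> : (s + k.+1).+1%:R / s.+1%:R =
    (s + k).+1%:R / s.+1%:R * (1 + (s + k).+1%:R^-1) :> R.
  rewrite addnS -[(s + k).+2%:R]natr1.
  have := ltr0Sn R (s + k); have := ltr0Sn R s.
  move: (_.+1%:R : R) (_.+1%:R : R) => x y x0 y0.
  by field; rewrite !gt_eqF.
rewrite lnM ?posrE ?divr_gt0 ?addr_gt0 //.
apply: lerD => //; apply: le_ln1Dx.
by rewrite (lt_le_trans (ltrN10 R)) ?invr_ge0.
Qed.

Lemma harmonic_le s k :
  \sum_(0 <= i < k) (s + i).+2%:R^-1 <= ln ((s + k).+1%:R / s.+1%:R) :> R.
Proof.
elim: k => [|k IHk]; first by rewrite addn0 divff // ln1 big_nil.
rewrite big_nat_recr //=.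
have -> : (s + k.+1).+1%:R / s.+1%:R =
    (s + k).+1%:R / s.+1%:R * (1 + - (s + k).+2%:R^-1)^-1 :> R.
  rewrite addnS -[(s + k).+2%:R]natr1.
  have := ltr0Sn R (s + k); have := ltr0Sn R s.
  move: (_.+1%:R : R) (_.+1%:R : R) => x y x0 y0.
  have y1 : y + 1 - 1 != 0 by rewrite addrK gt_eqF.
  by field; rewrite ?y1 !gt_eqF //; lra.
set z : R := (s + k).+2%:R^-1.
have z1 : z < 1 by rewrite invf_lt1 ?ltr1n.
rewrite lnM ?posrE ?divr_gt0 ?invr_gt0 ?subr_gt0 //.
apply: lerD => //; rewrite lnV ?posrE ?subr_gt0 // lerNr.
by apply: le_ln1Dx; rewrite ltrN2.
Qed.

(** With [c = 1 - e], each step has decay rate at least [(1 - e) ^+ 2 / (1 + e) >= 1 - 3 * e],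
    divided by the time. Initially all degrees are at least 1, so each term is at most [e^-1]. *)
Lemma Ex_inv_deg_sum s k g (e : R) : reachable s g -> 0 < e < 1 -> 3 * e <= 1 ->
  (forall i, (i < k)%N -> f (s + i).+1%:R <= e) -> (2 * s.+1%:R)^-1 <= e ->
  Ex f s k (inv_deg_sum (1 - e) (nverts g)) g <=
  (nverts g)%:R / e * expR (- ((1 - 3 * e) * ln ((s + k).+1%:R / s.+1%:R))).
Proof.
move=> rg /andP[e0 e1] e3 fe se; set n := nverts g.
have e01 : 0 < 1 - e < 1 by lra.
have inv0 i : 0 < (s + i).+1%:R^-1 :> R by rewrite invr_gt0.
have := @Ex_prod _ f f01 _ (@stable_above n) s k
  (fun i => expR (- ((1 - 3 * e) / (s + i).+1%:R))) (inv_deg_sum (1 - e) n) g.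
move=> /(_ (fun _ _ => expR_ge0 _)) Hp.
apply: (le_trans (Hp _ _)); last 1 first.
- rewrite -expR_sum mulrC sumrN -mulr_sumr; apply: ler_pM; rewrite ?expR_ge0 //.
  + by rewrite /inv_deg_sum big_seq sumr_ge0 // => v; rewrite mem_iota /= add0n => vn;
      rewrite invr_ge0; have : 1 <= (deg g v)%:R :> R; [rewrite ler1n; case: rg => _ _; apply|lra].
  + rewrite /inv_deg_sum (_ : n%:R / e = \sum_(v <- iota 0 n) e^-1); last first.
      by rewrite big_const_seq count_predT size_iota iter_addr_0 mulrC mulr_natr.
    rewrite big_seq [leRHS]big_seq; apply: ler_sum => v; rewrite mem_iota /= add0n => vn.
    have D1 : 1 <= (deg g v)%:R :> R by rewrite ler1n; case: rg => _ _; apply.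
    by rewrite lef_pV2 ?posrE //; lra.
  + rewrite ler_expR lerN2; apply: ler_wpM2l; [lra|exact: harmonic_ge].
- move=> i h ik [rh nh]; rewrite /inv_deg_sum step_sum mulr_sumr big_seq [leRHS]big_seq.
  apply: ler_sum => v; rewrite mem_iota /= add0n => vn.
  have vh := leq_trans vn nh.
  apply: (le_trans (step_inv_deg rh vh e01 (f01 _))).
  have D1 : 1 <= (deg h v)%:R :> R by rewrite ler1n; case: rh => _ _; apply.
  rewrite ler_pM2r; last by rewrite invr_gt0; lra.
  apply: le_trans (expR_ge1Dx _); rewrite lerD2l lerN2.
  rewrite ler_pM2r // (_ : 2 - (1 - e) = 1 + e); last by ring.
  rewrite ler_pdivlMr; last by lra.
  have h1 : 1 - e <= 1 - f (s + i).+1%:R by rewrite lerD2l lerN2 fe.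
  have h2 : 1 - e <= 1 - (2 * (s + i).+1%:R)^-1.
    rewrite lerD2l lerN2; apply: le_trans se.
    by rewrite lef_pV2 ?posrE ?mulr_gt0 // ler_pM2l // ler_nat ltnS leq_addr.
  apply: (@le_trans _ _ ((1 - e) * (1 - e))); first by nra.
  by apply: ler_pM => //; lra.
- by split.
Qed.

Definition low_deg (K n : nat) g : nat := count (fun v => (deg g v < K)%N) (iota 0 n).

Lemma low_deg_le t g K n (e : R) : reachable t g -> (n <= nverts g)%N -> 0 < e < 1 ->
  (low_deg K n g)%:R <= K%:R * inv_deg_sum (1 - e) n g.
Proof.
move=> rg ng e01; rewrite /low_deg /inv_deg_sum -sum1_count natr_sum mulr_sumr big_mkcond /=.
rewrite big_seq [leRHS]big_seq; apply: ler_sum => v; rewrite mem_iota /= add0n => vn.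
have D1 : 1 <= (deg g v)%:R :> R.
  by rewrite ler1n; case: rg => _ _; apply; exact: leq_trans vn ng.
have D0 : 0 < (deg g v)%:R - (1 - e) :> R by lra.
case: ifP => [DK|_]; last by rewrite mulr_ge0 // invr_ge0 ltW.
rewrite ler_pdivlMr // mul1r.
have : (deg g v)%:R <= K%:R :> R by rewrite ler_nat ltnW.
lra.
Qed.

(** Union bound over the pairs of vertices of degree at least [K]. Up to time [2 * u] the total
    degree before a step is at most [4 * u], and edge-steps have probability at least 1/2, so a pair
    is joined at each step with probability at least [2^-1 * (K / (4 * u)) ^+ 2 = x / u]; hence the
    32. *)
Lemma Ex_clique_high_deg u g n K (x : R) : reachable u g -> (n <= nverts g)%N ->
  (forall i, (i < u)%N -> f (u + i).+1%:R <= 2^-1) -> (0 < u)%N ->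
  x = K%:R ^+ 2 / (32 * u%:R) ->
  Ex f u u (fun h => (clique_number h < n - low_deg K n g)%N%:R) g <=
  n%:R ^+ 2 * expR (- x).
Proof.
move=> rg ng f2 u0 xE.
pose l := [seq v <- iota 0 n | ~~ (deg g v < K)%N].
have ul : uniq l by rewrite filter_uniq // iota_uniq.
have lP v : v \in l -> (K <= deg g v)%N /\ (v < n)%N.
  by rewrite mem_filter mem_iota -leqNgt => /andP[].
have szl : size l = (n - low_deg K n g)%N.
  rewrite size_filter -[X in (X - _)%N](size_iota 0 n).
  by rewrite -(count_predC (fun v => (deg g v < K)%N)) addKn.
rewrite -szl.
pose pairs := [seq q <- [seq (v, w) | v <- l, w <- l] | q.1 != q.2].
apply: (@le_trans _ _ (Ex f u u (fun h => \sum_(q <- pairs) nonadjacent q.1 q.2 h) g)).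
  apply: (ler_Ex f01 (@stable_above n)) => [h [rh nh]|]; last by split.
  case: ltnP => [small|_]; last by rewrite sumr_ge0.
  have : ~ clique_seq h l by move/leq_clique_number; rewrite leqNgt small.
  move=> ncl; have [q qp nq] : exists2 q, q \in pairs & ~~ Defs.adjacent h q.1 q.2.
    apply/hasP; apply: contra_notT ncl => /hasPn nh'; split=> //.
      by move=> v /lP[_ vn]; exact: leq_trans vn nh.
    move=> v w vl wl vw; apply/negPn; apply: (nh' (v, w)).
    by rewrite mem_filter vw; apply: allpairs_f.
  rewrite (big_rem q) //= /nonadjacent nq lerDl sumr_ge0 //.
rewrite Ex_sum.
apply: (@le_trans _ _ (\sum_(q <- pairs) expR (- x))); last first.
  rewrite big_const_seq count_predT iter_addr_0 -[leLHS]mulr_natl.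
  rewrite ler_wpM2r ?expR_ge0 // -natrX ler_nat -mulnn.
  apply: (@leq_trans (size [seq (v, w) | v <- l, w <- l])).
    by rewrite size_filter count_size.
  by rewrite size_allpairs szl leq_mul // leq_subr.
rewrite big_seq [leRHS]big_seq; apply: ler_sum => q; rewrite mem_filter => /andP[_].
move=> /allpairsP[[v w] /= [/lP[Kv vn] /lP[Kw wn] ->]] /=.
pose J t h := reachable t h /\ [/\ (n <= nverts h)%N, (K <= deg h v)%N & (K <= deg h w)%N].
have stJ : stable J.
  move=> t h [rh [nh vh wh]]; have [rv re] := stable_reachable rh.
  split=> [y|y z]; split; [exact: rv| |exact: re|]; split.
  - exact: leqW.
  - by rewrite deg_add_vertex (leq_trans vh) // leq_addl.
  - by rewrite deg_add_vertex (leq_trans wh) // leq_addl.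
  - by [].
  - by rewrite deg_add_edge (leq_trans vh) // leq_addl.
  - by rewrite deg_add_edge (leq_trans wh) // leq_addl.
have u0' : 0 < u%:R :> R by rewrite ltr0n.
pose c : R := 1 - x / u%:R.
have ce : c <= expR (- (x / u%:R)) by exact: expR_ge1Dx.
have := @Ex_prod _ f f01 J stJ u u (fun=> expR (- (x / u%:R))) (nonadjacent v w) g.
move=> /(_ (fun _ _ => expR_ge0 _)) Hp.
apply: (le_trans (Hp _ _)).
- move=> i h iu [rh [nh vh wh]].
  have vh' := leq_trans vn nh; have wh' := leq_trans wn nh.
  apply: (le_trans (step_nonadjacent (K := K%:R) rh vh' wh' (f01 _) _ _ _)); rewrite ?ler_nat //.
  apply: ler_wpM2r; first by rewrite ler0n.
  apply: le_trans ce; rewrite lerD2l lerN2 xE.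
  have -> : K%:R ^+ 2 / (32 * u%:R) / u%:R = 2^-1 * (K%:R / (4 * u%:R)) ^+ 2 :> R.
    by field; rewrite gt_eqF.
  apply: ler_pM; rewrite ?exprn_ge0 ?divr_ge0 ?invr_ge0 //.
    by have := f2 i iu; lra.
  rewrite lerXn2r ?nnegrE ?divr_ge0 ?mulr_ge0 //.
  rewrite ler_wpM2l // lef_pV2 ?posrE ?mulr_gt0 //.
  by rewrite -!natrM ler_nat; lia.
- by split.
rewrite prodr_const card_ord -expRM_natr.
have -> : - (x / u%:R) * u%:R = - x by field; rewrite gt_eqF.
by rewrite ler_piMr ?expR_ge0 // /nonadjacent; case: (~~ _).
Qed.

(** Degrees grow from [s] to [u], edges appear from [u] to [2 * u]. By Markov's inequality at time
    [u], more than half of the old vertices have low degree with probability at most the first term;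
    otherwise the high-degree ones, at least half, become a clique unless some pair is missed, which
    is the second term. *)
Lemma Ex_small_clique s u k g K (e r : R) : reachable s g -> (s + k = u)%N -> (0 < u)%N ->
  0 < e < 1 -> 3 * e <= 1 ->
  (forall i, (s < i)%N -> f i%:R <= e) -> (2 * s.+1%:R)^-1 <= e ->
  r = expR (- ((1 - 3 * e) * ln (u.+1%:R / s.+1%:R))) ->
  Ex f s (k + u) (fun h => (2 * clique_number h < nverts g)%N%:R) g <=
  2 * K%:R * r / e + s.+1%:R ^+ 2 * expR (- (K%:R ^+ 2 / (32 * u%:R))).
Proof.
move=> rg sk u0 e01 e3 fe se rE; set n := nverts g.
set y : R := expR (- (K%:R ^+ 2 / _)).
have n0 : (0 < n)%N by case: rg => _ /andP[].
have ns : (n <= s.+1)%N by case: rg => _ /andP[].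
have n0' : 0 < n%:R :> R by rewrite ltr0n.
rewrite Ex_add sk.
apply: (@le_trans _ _ (Ex f s k (fun h => (2 * K%:R / n%:R) * inv_deg_sum (1 - e) n h +
   s.+1%:R ^+ 2 * y) g)).
  apply: (ler_Ex f01 (@stable_above n)) => [h [rh nh]|]; last by split.
  rewrite sk in rh.
  have S0 : 0 <= K%:R * inv_deg_sum (1 - e) n h.
    by apply: le_trans (low_deg_le K rh nh e01).
  have KE : 2 * K%:R / n%:R * inv_deg_sum (1 - e) n h =
      2 * (K%:R * inv_deg_sum (1 - e) n h) / n%:R by ring.
  have y0 : 0 <= s.+1%:R ^+ 2 * y by rewrite mulr_ge0 ?exprn_ge0 ?expR_ge0.
  have [low|high] := ltnP n (2 * low_deg K n h).
    apply: (@le_trans _ _ 1).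
      rewrite -[leRHS](Ex_cst f01 u 1 rh).
      by apply: (ler_Ex f01 stable_reachable) => // ? _; rewrite lern1 leq_b1.
    rewrite -[leLHS]addr0; apply: lerD => //.
    rewrite KE ler_pdivlMr // mul1r.
    apply: (@le_trans _ _ (2 * (low_deg K n h)%:R)); first by rewrite -natrM ler_nat ltnW.
    by rewrite ler_pM2l // (low_deg_le K rh nh e01).
  apply: (@le_trans _ _ (n%:R ^+ 2 * y)).
    apply: (@le_trans _ _ (Ex f u u (fun x => (clique_number x < n - low_deg K n h)%N%:R) h)).
      apply: (ler_Ex f01 stable_reachable) => // x _.
      apply: ler_bool; move: high; rewrite -/n.
      by move: (low_deg _ _ _) (clique_number _) => a b; lia.
    apply: (Ex_clique_high_deg rh nh) => // i iu.
    apply: (@le_trans _ _ e); last by lra.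
    by apply: fe; lia.
  apply: ler_wpDl.
    by rewrite KE divr_ge0 // mulr_ge0.
  by rewrite ler_wpM2r ?expR_ge0 // lerXn2r ?nnegrE // ler_nat.
rewrite ExD Ex_cst // lerD2r ExZ.
have := @Ex_inv_deg_sum s k g e rg e01 e3 _ se.
rewrite sk -rE -/n => H.
have {}H : Ex f s k (inv_deg_sum (1 - e) n) g <= n%:R / e * r.
  by apply: H => i _; apply: fe; rewrite ltnS leq_addr.
have Kn : 0 <= 2 * K%:R / n%:R :> R by rewrite divr_ge0 // mulr_ge0.
apply: (le_trans (ler_wpM2l Kn H)).
rewrite le_eqVlt; apply/orP; left; apply/eqP; field.
by case/andP: e01 => e0 _; rewrite !gt_eqF.
Qed.

Lemma Ex_clique_lower s u k K (e F r : R) : (s + k = u)%N -> (0 < u)%N ->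
  0 < e < 1 -> 3 * e <= 1 ->
  (forall i, (s < i)%N -> f i%:R <= e) -> (2 * s.+1%:R)^-1 <= e ->
  r = expR (- ((1 - 3 * e) * ln (u.+1%:R / s.+1%:R))) ->
  0 < F -> F <= \sum_(i < s) f i.+1%:R ->
  Ex f 0 (u + u) (fun h => ((clique_number h)%:R < F / 8)%R%:R) loop_graph <=
  4 / F + (2 * K%:R * r / e + s.+1%:R ^+ 2 * expR (- (K%:R ^+ 2 / (32 * u%:R)))).
Proof.
move=> sk u0 e01 e3 fe se rE F0 leF.
rewrite -{1}sk -addnA Ex_add add0n; set b := (X in _ + X).
have rl := reachable_loop.
apply: (@le_trans _ _ (Ex f 0 s (fun h => ((nverts h)%:R < F / 4)%R%:R + b) loop_graph)).
  apply: (ler_Ex f01 stable_reachable) => // g rg; rewrite add0n in rg.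
  have [Vlt|Vge] := ltP.
    apply: (@le_trans _ _ 1).
      rewrite -[leRHS](Ex_cst f01 (k + u) 1 rg).
      by apply: (ler_Ex f01 stable_reachable) => // ? _; rewrite lern1 leq_b1.
    have /andP[/ltW e0 _] := e01.
    by rewrite lerDl addr_ge0 ?divr_ge0 ?mulr_ge0 ?exprn_ge0 ?rE ?expR_ge0.
  rewrite add0r; apply: le_trans (Ex_small_clique K rg sk u0 e01 e3 fe se rE).
  apply: (ler_Ex f01 stable_reachable) => // h _.
  by apply: ler_bool => hlt; rewrite -(ltr_nat R) natrM; lra.
by rewrite ExD Ex_cst // lerD2r; exact: Ex_few_nverts.
Qed.

End LowerTail.

(** * Geometric tail bounds *)

Section Geometric.
Context {R : realType}.
Implicit Types (x : nat -> R).

(** The constant absorbs the finitely many terms before the ratio bound starts. *)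
Lemma ratio_upper_bound x q k0 : 0 < q ->
  (forall k, (k0 <= k)%N -> x k.+1 <= q * x k) ->
  exists2 C, 1 <= C & forall k, x k <= C * q ^+ k.
Proof.
move=> q0; elim: k0 x => [|k0 IHk0] x hx.
  exists (`|x 0%N| + 1); first by rewrite lerDr.
  elim=> [|k IHk]; first by rewrite mulr1 ler_wpDr // ler_norm.
  by rewrite (le_trans (hx k _)) // exprS mulrCA ler_pM2l.
have [C C1 hC] := IHk0 (fun k => x k.+1) (fun k hk => hx k.+1 hk).
have Cq : 0 <= C / q by rewrite divr_ge0 // ?ltW // (lt_le_trans ltr01).
exists (`|x 0%N| + C / q + 1); first by rewrite lerDr addr_ge0.
case=> [|k]; first by rewrite mulr1 -addrA ler_wpDr ?ler_norm // addr_ge0.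
apply: (le_trans (hC k)); rewrite exprS mulrA ler_pM2r ?exprn_gt0 //.
rewrite -ler_pdivrMr // addrAC lerDr addr_ge0 //.
Qed.

Lemma linear_le_geometric (rho : R) k : 1 < rho ->
  k.+1%:R <= (1 + (rho - 1)^-1) * rho ^+ k.
Proof.
move=> rho1; have r0 : 0 < rho - 1 by rewrite subr_gt0.
have bern : 1 + k%:R * (rho - 1) <= rho ^+ k.
  elim: k => [|k IHk]; first by rewrite mul0r addr0.
  rewrite exprS; apply: (@le_trans _ _ (rho * (1 + k%:R * (rho - 1)))).
    rewrite -natr1; have := mulr_ge0 (ler0n R k) (sqr_ge0 (rho - 1)); lra.
  by rewrite ler_pM2l // (lt_trans ltr01).
apply: (@le_trans _ _ ((1 + (rho - 1)^-1) * (1 + k%:R * (rho - 1)))).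
  rewrite -natr1 mulrDl mul1r.
  have -> : (rho - 1)^-1 * (1 + k%:R * (rho - 1)) = (rho - 1)^-1 + k%:R.
    by field; rewrite gt_eqF.
  have : 0 <= (rho - 1)^-1 by rewrite invr_ge0 ltW.
  have : 0 <= k%:R * (rho - 1) by rewrite mulr_ge0 // ltW.
  lra.
by rewrite ler_pM2l // addr_gt0 // invr_gt0.
Qed.

Lemma ln2_le1 : ln (2 : R) <= 1.
Proof. by rewrite (_ : 2 = 1 + 1 :> R) // le_ln1Dx // (lt_le_trans (ltrN10 R)). Qed.

End Geometric.

Section Tails.
Context {R : realType} (f : R -> R).
Hypothesis f_range : forall x : R, 0 < x -> 0 < f x <= 1.
Hypothesis f_decr : forall x y : R, 0 < x -> x <= y -> f y <= f x.

Lemma f01_nat (t : nat) : 0 <= f t.+1%:R <= 1.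
Proof. by have /andP[/ltW -> ->] := f_range (ltr0Sn R t). Qed.

Lemma f_decr_nat m n : (0 < m)%N -> (m <= n)%N -> f n%:R <= f m%:R.
Proof. by move=> m0 mn; rewrite f_decr ?ltr0n ?ler_nat. Qed.

(** Dyadic blocks: the block after [2 ^ k] contributes at most [C * (2 * q) ^+ k], and [1 <= 2 * q]
    makes the last bound the largest, whence the factor [k]. *)
Lemma sum_f_pow2 (C q : R) k : 0 <= C -> 1 <= 2 * q ->
  (forall k, f (2 ^+ k) <= C * q ^+ k) ->
  \sum_(i < 2 ^ k) f i.+1%:R <= 1 + C * k%:R * (2 * q) ^+ k.
Proof.
move=> C0 q1 fC; elim: k => [|k IHk].
  by rewrite big_ord1 mulr0 mul0r addr0; case/andP: (f01_nat 0).
have -> : \sum_(i < 2 ^ k.+1) f i.+1%:R =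
    \sum_(i < 2 ^ k) f i.+1%:R + \sum_(i < 2 ^ k) f (2 ^ k + i).+1%:R.
  by rewrite expnS mul2n -addnn big_split_ord.
have half : \sum_(i < 2 ^ k) f (2 ^ k + i).+1%:R <= C * (2 * q) ^+ k.
  apply: (@le_trans _ _ (\sum_(i < 2 ^ k) (C * q ^+ k))).
    apply: ler_sum => i _; apply: le_trans (fC k); rewrite -natrX.
    by apply: f_decr_nat; rewrite ?expn_gt0 // -addnS leq_addr.
  by rewrite sumr_const card_ord -[leLHS]mulr_natr natrX exprMn -mulrA (mulrC (q ^+ k)).
have mono : (2 * q) ^+ k <= (2 * q) ^+ k.+1 by rewrite ler_weXn2l.
have pos : 0 <= (2 * q) ^+ k by rewrite exprn_ge0 // (le_trans ler01).
apply: (le_trans (lerD IHk half)); rewrite -addrA lerD2l.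
have -> : C * k%:R * (2 * q) ^+ k + C * (2 * q) ^+ k = C * k.+1%:R * (2 * q) ^+ k.
  by rewrite -natr1; ring.
by apply: ler_wpM2l => //; rewrite mulr_ge0.
Qed.

(** A clique larger than [2 * B] forces either at least [B] early vertices or more than [B] late
    clique vertices, hence many late edges; Markov's inequality is applied to each alternative. *)
Lemma Ex_clique_upper s k (p h B : R) : 0 < B -> (0 < s)%N ->
  f s%:R <= p -> s.+2%:R^-1 <= p ->
  \sum_(0 <= i < k) (s + i).+2%:R^-1 <= h ->
  Ex f 0 (s + k) (fun x => (2 * B < (clique_number x)%:R)%R%:R) loop_graph <=
  (1 + \sum_(i < s) f i.+1%:R) / B +
  (4 * (k%:R * p ^+ 2 * (h + 2) ^+ 2) + 1) / B ^+ 2.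
Proof.
move=> B0 s0 fp sp Hh; rewrite Ex_add add0n.
have f01 := f01_nat; have B20 : 0 < B ^+ 2 by rewrite exprn_gt0.
set b := (X in _ <= _ + X).
apply: (@le_trans _ _ (Ex f 0 s (fun g => B^-1 * (nverts g)%:R + b) loop_graph)); last first.
  rewrite ExD ExZ Ex_cst //; last exact: reachable_loop.
  by rewrite lerD2r mulrC ler_pM2r ?invr_gt0 // Ex_nverts.
apply: (ler_Ex f01 stable_reachable); last exact: reachable_loop.
move=> g; rewrite add0n => rg; set n := nverts g.
apply: (@le_trans _ _ (Ex f s k (fun x => B^-1 * n%:R +
   ((4 / B ^+ 2) * (late_edges n x)%:R + (B ^+ 2)^-1)) g)).
  apply: (ler_Ex f01 stable_reachable) => // x _.
  have late0 : 0 <= 4 / B ^+ 2 * (late_edges n x)%:R + (B ^+ 2)^-1.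
    by rewrite addr_ge0 ?mulr_ge0 ?invr_ge0 // ?divr_ge0 ?ltW.
  have n0 : 0 <= B^-1 * n%:R by rewrite mulr_ge0 // invr_ge0 ltW.
  have [big|_] := ltP; last by rewrite addr_ge0.
  have [nB|Bn] := leP B n%:R.
    by rewrite ler_wpDr // mulrC ler_pdivlMr // mul1r.
  rewrite ler_wpDl //.
  have -> : 4 / B ^+ 2 * (late_edges n x)%:R + (B ^+ 2)^-1 =
     (4 * late_edges n x + 1)%:R / B ^+ 2.
    by rewrite natrD natrM; ring.
  rewrite ler_pdivlMr // mul1r.
  apply: (@le_trans _ _ (((clique_number x - n) ^ 2)%N%:R)); last first.
    by rewrite ler_nat leq_clique_late.
  have nc : (n <= clique_number x)%N by rewrite -(ler_nat R); lra.
  rewrite natrX natrB // lerXn2r ?nnegrE ?(ltW B0) ?subr_ge0 ?ler_nat //; lra.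
rewrite ExD Ex_cst // lerD2l ExD ExZ Ex_cst //.
rewrite (_ : b = 4 / B ^+ 2 * (k%:R * p ^+ 2 * (h + 2) ^+ 2) + (B ^+ 2)^-1); last first.
  by rewrite /b; ring.
rewrite lerD2r.
apply: ler_wpM2l; first by rewrite divr_ge0 // ltW.
apply: Ex_late_edges => // i ik; apply: le_trans fp.
by apply: f_decr_nat => //; rewrite -addnS leq_addr.
Qed.

(** Of the two factors [rho], one absorbs the polynomial factors in [k] (the number of dyadic blocks
    and the harmonic sum), and the other yields the geometric decay. *)
Lemma clique_upper_tail (C q rho : R) : 1 <= C -> 1 <= 2 * q -> 1 < rho ->
  (forall k, f (2 ^+ k) <= C * q ^+ k) ->
  exists D, forall k,
    Ex f 0 (4 ^ k) (fun x => (2 * (2 * q * rho ^+ 2) ^+ k < (clique_number x)%:R)%R%:R)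
      loop_graph <= D * rho^-1 ^+ k.
Proof.
move=> C1 q1 rho1 fC.
set C1' := 1 + (rho - 1)^-1.
have rho0 : 0 < rho by rewrite (lt_trans ltr01).
have q0 : 0 < q by lra.
have qr0 : 1 <= 2 * q * rho by rewrite -[leLHS]mulr1; apply: ler_pM => //; exact: ltW.
have C1'0 : 1 <= C1' by rewrite /C1' lerDl invr_ge0 subr_ge0 ltW.
exists ((2 + C) * C1' + (16 * C ^+ 2 * C1' ^+ 2 + 1)) => k.
have s0 : (0 < 2 ^ k)%N by rewrite expn_gt0.
have sT : (2 ^ k <= 4 ^ k)%N by case: (k) => // j; rewrite leq_exp2r.
have B0 : 0 < (2 * q * rho ^+ 2) ^+ k.
  by rewrite exprn_gt0 // mulr_gt0 ?exprn_gt0 // mulr_gt0.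
have qk0 : 0 < q ^+ k by rewrite exprn_gt0.
have lin := linear_le_geometric k rho1; rewrite -/C1' in lin.
pose X := (2 * q * rho) ^+ k.
have X1 : 1 <= X by rewrite exprn_ege1.
have BE : (2 * q * rho ^+ 2) ^+ k = X * rho ^+ k.
  by rewrite /X -exprMn; congr (_ ^+ _); ring.
have rk0 : 0 < rho ^+ k by rewrite exprn_gt0.
have rk1 : 1 <= rho ^+ k by rewrite exprn_ege1 // ltW.
have fs : f (2 ^ k)%:R <= C * q ^+ k by rewrite natrX.
have sp : (2 ^ k).+2%:R^-1 <= C * q ^+ k.
  apply: (@le_trans _ _ (q ^+ k)); last by rewrite ler_peMl // ltW.
  apply: (@le_trans _ _ (2^-1 ^+ k)).
    by rewrite exprVn lef_pV2 ?posrE ?exprn_gt0 // -natrX ler_nat !leqW.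
  by rewrite lerXn2r ?nnegrE //; lra.
have hs : \sum_(0 <= i < 4 ^ k - 2 ^ k) (2 ^ k + i).+2%:R^-1 <= 2 * k%:R :> R.
  apply: (le_trans (harmonic_le _ _)); rewrite subnKC //.
  apply: (@le_trans _ _ (ln (4 ^+ k))).
    rewrite ler_ln ?posrE ?divr_gt0 ?exprn_gt0 // ler_pdivrMr // -natrX -natrM ler_nat.
    by rewrite mulnS -add1n leq_add ?expn_gt0 // leq_pmulr.
  rewrite lnXn // (_ : 4 = 2 * 2 :> R); last by rewrite -natrM.
  rewrite lnM ?posrE // -[leLHS]mulr_natr ler_wpM2r //.
  by have := @ln2_le1 R; lra.
have := Ex_clique_upper B0 s0 fs sp hs; rewrite subnKC // => H; apply: (le_trans H).
have h1 : 1 + \sum_(i < 2 ^ k) f i.+1%:R <= (2 + C) * C1' * X.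
  have q2k : 1 <= (2 * q) ^+ k by rewrite exprn_ege1.
  have := sum_f_pow2 k (le_trans ler01 C1) q1 fC.
  have : (2 + C) * k.+1%:R * (2 * q) ^+ k <= (2 + C) * C1' * X.
    rewrite (_ : X = rho ^+ k * (2 * q) ^+ k); last by rewrite /X exprMn mulrC.
    rewrite mulrA ler_pM2r ?(lt_le_trans ltr01) // -mulrA ler_pM2l //; lra.
  have : 2 + C * k%:R * (2 * q) ^+ k <= (2 + C) * k.+1%:R * (2 * q) ^+ k.
    rewrite -natr1.
    have : 0 <= C * (2 * q) ^+ k by rewrite mulr_ge0 //; lra.
    have : 0 <= k%:R * (2 * q) ^+ k by rewrite mulr_ge0 //; lra.
    lra.
  lra.
have h2 : 4 * ((4 ^ k - 2 ^ k)%:R * (C * q ^+ k) ^+ 2 * (2 * k%:R + 2) ^+ 2) + 1 <=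
    (16 * C ^+ 2 * C1' ^+ 2 + 1) * X ^+ 2.
  rewrite [leRHS]mulrDl mul1r; apply: lerD; last by rewrite exprn_ege1.
  have -> : 16 * C ^+ 2 * C1' ^+ 2 * X ^+ 2 =
     4 * (4 ^+ k * (C * q ^+ k) ^+ 2 * (2 * (C1' * rho ^+ k)) ^+ 2).
    have E4 : 4 ^+ k = (2 ^+ k) ^+ 2 :> R.
      by rewrite exprAC; congr (_ ^+ k); rewrite expr2 -natrM.
    have XE : X = 2 ^+ k * q ^+ k * rho ^+ k by rewrite /X !exprMn.
    by rewrite XE E4; move: (2 ^+ k) (q ^+ k) (rho ^+ k) => x y z; ring.
  rewrite ler_pM2l //; apply: ler_pM;
    [exact: mulr_ge0 (ler0n _ _) (sqr_ge0 _)|exact: sqr_ge0| |].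
    by rewrite ler_wpM2r ?sqr_ge0 // -natrX ler_nat leq_subr.
  rewrite lerXn2r ?nnegrE ?addr_ge0 ?mulr_ge0 ?(ltW rk0) //; first by lra.
  by rewrite (_ : 2 * k%:R + 2 = 2 * k.+1%:R :> R) ?ler_pM2l // -natr1; ring.
rewrite [leRHS]mulrDl; apply: lerD.
  rewrite ler_pdivrMr // (le_trans h1) // le_eqVlt; apply/orP; left; apply/eqP.
  by rewrite BE exprVn; field; rewrite gt_eqF.
rewrite ler_pdivrMr; last by rewrite exprn_gt0.
apply: (le_trans h2).
rewrite -[leRHS]mulrA; apply: ler_wpM2l.
  apply: addr_ge0 => //; apply: mulr_ge0; last exact: sqr_ge0.
  by apply: mulr_ge0; last exact: sqr_ge0.
rewrite BE exprVn (_ : (rho ^+ k)^-1 * (X * rho ^+ k) ^+ 2 = X ^+ 2 * rho ^+ k).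
  by rewrite ler_peMr // sqr_ge0.
by field; rewrite gt_eqF.
Qed.


End Tails.

Section LowerTailGeometric.
Context {R : realType} (f : R -> R).
Hypothesis f_range : forall x : R, 0 < x -> 0 < f x <= 1.
Hypothesis f_decr : forall x y : R, 0 < x -> x <= y -> f y <= f x.
Hypothesis f_small : forall e : R, 0 < e ->
  exists n0, forall n, (n0 <= n)%N -> f n%:R <= e.

(** Polynomial decay of order [N.+1] in [4 ^+ k] suffices against the [4 ^+ (N * k)] pairs in the
    union bound. *)
Lemma expRN_le_fact (y : R) n : 0 < y -> expR (- y) <= n.+1`!%:R / y ^+ n.+1.
Proof.
move=> y0; have yn : 0 < y ^+ n.+1 by rewrite exprn_gt0.
have fn : 0 < n.+1`!%:R :> R by rewrite ltr0n fact_gt0.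
rewrite expRN -[leRHS]invf_div lef_pV2 ?posrE ?expR_gt0 ?divr_gt0 //.
by apply: le_trans (expR_ge1Dxn n (ltW y0)); rewrite lerDr.
Qed.

Lemma pow2_expR k : 2 ^+ k = expR (k%:R * ln 2) :> R.
Proof. by rewrite expRM_natl lnK ?posrE. Qed.

Lemma clique_lower_tail (c q : R) N : 0 < c -> 1 < 2 * q -> (0 < N)%N ->
  (forall k, c * q ^+ k <= f (2 ^+ k)) ->
  exists D th k0, [/\ 0 <= D, 0 <= th < 1 & forall k, (k0 <= k)%N ->
    Ex f 0 (2 ^ ((2 * N + 4) * k) + 2 ^ ((2 * N + 4) * k))
      (fun h => ((clique_number h)%:R < c * (2 * q) ^+ (N * k) / 8)%R%:R)
      loop_graph <= D * th ^+ k].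
Proof.
move=> c0 q1 N0 cf; have f01 := f01_nat f_range.
have N40 : 0 < (N + 4)%:R :> R by rewrite ltr0n addn4.
(* The loss [3 * e] in the growth rate, over a time ratio of [2 ^ ((N + 4) * k)], then costs only a
   factor [2 ^ (k / 2)], half of the margin between [K] and that ratio in the exponent. *)
have [e [e0 eN]] : exists e : R, 0 < e /\ 3 * e * (N + 4)%:R = 2^-1.
  exists (6 * (N + 4)%:R)^-1; split; first by rewrite invr_gt0 mulr_gt0.
  by field; rewrite gt_eqF.
have N4 : 4 <= (N + 4)%:R :> R by rewrite ler_nat leq_addl.
have e3 : 3 * e <= 2^-1 by rewrite -eN ler_peMr ?mulr_ge0 ?(ltW e0) //; lra.
have [n0 fn0] := f_small e0.
have ln2_gt0 : 0 < ln 2 :> R by rewrite ln_gt0 // ltr1n.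
pose th1 : R := expR (- (ln 2 / 2)).
pose th3 : R := (2 * q)^-1 ^+ N.
(* The three rates belong to the low-degree vertices, to the missing edges and to the shortage of
   vertices at time [s]. *)
pose th := Num.max th1 (Num.max 4^-1 th3).
have th1_1 : 0 <= th1 < 1.
  by rewrite expR_ge0 -[ltRHS]expR0 ltr_expR oppr_lt0 divr_gt0.
have q20 : 0 < 2 * q by rewrite (lt_trans ltr01).
have th3_1 : 0 <= th3 < 1.
  rewrite exprn_ge0 ?invr_ge0 ?(ltW q20) //=.
  by rewrite exprn_ilt1 ?invr_ge0 ?(ltW q20) // ?invf_lt1 // -lt0n.
have th_1 : 0 <= th < 1.
  rewrite /th !gt_max !le_max; case/andP: th1_1 => -> ->; case/andP: th3_1 => _ -> /=.
  by rewrite invf_lt1 // ltr1n.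
have thmax x k : 0 <= x -> x <= th -> x ^+ k <= th ^+ k.
  by move=> x0 xth; rewrite lerXn2r ?nnegrE //; case/andP: th_1.
(* The lower limit on [k] makes [s] so large that both [f] and [1 / (2 * s.+1)] are at most [e] from
   then on. *)
exists (4 / c + (4 / e + 4 * N.+1`!%:R * 32 ^+ N.+1)), th, (maxn n0 (3 * (N + 4))).
split=> //.
  by rewrite !addr_ge0 ?mulr_ge0 ?invr_ge0 ?exprn_ge0 // ltW.
move=> k; rewrite geq_max => /andP[kn0 kN].
set s := (2 ^ (N * k))%N; set u := (2 ^ ((2 * N + 4) * k))%N.
have sE : s%:R = 2 ^+ (N * k) :> R by rewrite natrX.
have ks : (k <= s)%N.
  by rewrite (leq_trans (ltnW (ltn_expl k (isT : 1 < 2)%N))) // leq_exp2l // leq_pmull.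
have s0 : (0 < s)%N by rewrite expn_gt0.
have u0 : (0 < u)%N by rewrite expn_gt0.
have us : u = (2 ^ ((N + 4) * k) * s)%N.
  by rewrite -expnD -mulnDl; congr (2 ^ (_ * _))%N; rewrite mul2n -addnn addnAC.
have su : (s <= u)%N by rewrite us leq_pmull // expn_gt0.
pose K := (2 ^ ((N + 3) * k))%N.
have KE : K%:R = 2 ^+ ((N + 3) * k) :> R by rewrite natrX.
have Ku : (K ^ 2 = 4 ^ k * u)%N.
  rewrite -expnM -(expnM 2 2) -expnD -mulnDl mulnAC; congr (2 ^ (_ * _))%N.
  by rewrite mulnDl mulnC addnA [(2 + _)%N]addnC -addnA.
clearbody s u K.
pose F := c * (2 * q) ^+ (N * k).
have F0 : 0 < F := mulr_gt0 c0 (exprn_gt0 _ q20).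
have FE : F <= \sum_(i < s) f i.+1%:R.
  apply: (@le_trans _ _ (\sum_(i < s) (c * q ^+ (N * k)))).
    by rewrite sumr_const card_ord -[leRHS]mulr_natr sE /F exprMn -mulrA [q ^+ _ * _]mulrC.
  apply: ler_sum => i _; apply: (le_trans (cf _)); rewrite -sE.
  exact: (f_decr_nat f_decr).
have fe i : (s < i)%N -> f i%:R <= e.
  by move=> si; apply: fn0; rewrite (leq_trans kn0) // (leq_trans ks) // ltnW.
have se : (2 * s.+1%:R)^-1 <= e.
  have sN : 3 * (N + 4)%:R <= s.+1%:R :> R by rewrite -natrM ler_nat leqW // (leq_trans kN).
  rewrite -div1r ler_pdivrMr ?mulr_gt0 //.
  by have := ler_wpM2l (ltW e0) sN; lra.
have e01 : 0 < e < 1 by rewrite e0; lra.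
have e31 : 3 * e <= 1 by lra.
apply: (le_trans (Ex_clique_lower f01 K (subnKC su) u0 e01 e31 fe se erefl F0 FE)).
rewrite [leRHS]mulrDl; apply: lerD.
  have -> : 4 / F = 4 / c * ((2 * q) ^+ (N * k))^-1 by rewrite /F invfM mulrA.
  apply: ler_wpM2l; first by rewrite divr_ge0 // ltW.
  apply: le_trans (thmax th3 k _ _); last 2 first.
  - by case/andP: th3_1.
  - by rewrite /th !le_max lexx !orbT.
  by rewrite /th3 -exprM exprVn.
rewrite [leRHS]mulrDl; apply: lerD.
  have lnus : (N + 4)%:R * k%:R * ln 2 - ln 2 <= ln (u.+1%:R / s.+1%:R) :> R.
    rewrite [leLHS](_ : _ = ln (2 ^+ ((N + 4) * k) / 2)); last first.
      by rewrite ln_div ?posrE ?exprn_gt0 // lnXn // -natrM mulr_natl.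
    rewrite ler_ln ?posrE ?divr_gt0 ?exprn_gt0 //.
    rewrite ler_pdivlMr // mulrAC ler_pdivrMr // -natrX -!natrM ler_nat.
    by rewrite us; move: (2 ^ _)%N => X; clear -s0; nia.
  set r := expR _.
  have Kr : K%:R * r <= 2 * th1 ^+ k.
    have -> : 2 * th1 ^+ k = expR (ln 2 + k%:R * (- (ln 2 / 2))).
      by rewrite expRD lnK ?posrE // expRM_natl.
    rewrite KE pow2_expR -expRD ler_expR natrM.
    have e3' : 0 <= 1 - 3 * e by lra.
    have := ler_wpM2l e3' lnus.
    have eNk : 3 * e * (N + 4)%:R * (k%:R * ln 2) = 2^-1 * (k%:R * ln 2) by rewrite eN.
    have : 0 <= 3 * e * ln 2 by rewrite mulr_ge0 ?mulr_ge0 // ltW.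
    move: eNk; rewrite !natrD.
    move: (ln (_ / _)) => l; lra.
  have -> : 2 * K%:R * r / e = 2 / e * (K%:R * r) by ring.
  have -> : 4 / e * th ^+ k = 2 / e * (2 * th ^+ k) by ring.
  apply: ler_wpM2l; first by rewrite divr_ge0 // ltW.
  apply: (le_trans Kr); rewrite ler_pM2l //; apply: thmax; first by case/andP: th1_1.
  by rewrite /th le_max lexx.
have yE : K%:R ^+ 2 / (32 * u%:R) = 4 ^+ k / 32 :> R.
  have -> : K%:R ^+ 2 = 4 ^+ k * u%:R :> R.
    by rewrite -natrX Ku natrM natrX.
  by field; rewrite pnatr_eq0 -lt0n.
rewrite yE.
have y0 : 0 < 4 ^+ k / 32 :> R by rewrite divr_gt0 // exprn_gt0.
apply: (@le_trans _ _ ((4 * 4 ^+ (N * k)) * (N.+1`!%:R / (4 ^+ k / 32) ^+ N.+1))).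
  apply: ler_pM; rewrite ?exprn_ge0 ?expR_ge0 //; last exact: expRN_le_fact.
  have -> : 4 * 4 ^+ (N * k) = (2 * s%:R) ^+ 2 :> R.
    have E4 : 4 = 2 ^+ 2 :> R by rewrite expr2 -natrM.
    by rewrite sE exprMn exprAC -E4.
  by rewrite lerXn2r ?nnegrE ?mulr_ge0 // -natrM ler_nat mul2n -addnn -add1n leq_add2r.
have -> : 4 * 4 ^+ (N * k) * (N.+1`!%:R / (4 ^+ k / 32) ^+ N.+1) =
   4 * N.+1`!%:R * 32 ^+ N.+1 * (4^-1) ^+ k :> R.
  rewrite expr_div_n -exprM mulnS exprD (mulnC k N) exprVn.
  have z1 : 4 ^+ k != 0 :> R by rewrite expf_neq0 // pnatr_eq0.
  have z2 : 4 ^+ (N * k) != 0 :> R by rewrite expf_neq0 // pnatr_eq0.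
  have z3 : 32 ^+ N.+1 != 0 :> R by rewrite expf_neq0 // pnatr_eq0.
  move: (4 ^+ k) (4 ^+ (N * k)) (32 ^+ N.+1) (_`!%:R) z1 z2 z3 => a b d x z1 z2 z3.
  by field; rewrite z1 z2 z3.
apply: ler_wpM2l; first by rewrite !mulr_ge0 ?exprn_ge0.
by apply: thmax; rewrite ?invr_ge0 // /th !le_max lexx !orbT.
Qed.

End LowerTailGeometric.

(** * From geometric times to all times *)

Lemma borel_cantelli_geometric (R : realType) d (T : measurableType d)
    (P : probability T R) (A : nat -> set T) (D th : R) k0 :
  (forall k, measurable (A k)) -> 0 <= D -> 0 <= th < 1 ->
  (forall k, (k0 <= k)%N -> (P (A k) <= (D * th ^+ k)%:E)%E) ->
  {ae P, forall w, exists k1, forall k, (k1 <= k)%N -> ~ A k w}.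
Proof.
move=> mA D0 /andP[th0 th1] PA.
pose F k := A (k0 + k)%N.
have mF k : measurable (F k) by exact: mA.
have th1' : 0 < 1 - th by rewrite subr_gt0.
have geo n : \sum_(0 <= k < n) (D * th ^+ k) <= D / (1 - th).
  rewrite -mulr_sumr; apply: ler_wpM2l => //; rewrite -div1r ler_pdivlMr //.
  rewrite mulrC big_mkord -[X in _ * X]/(\sum_(i < n) th ^+ i).
  by have := subrX1 th n; have := exprn_ge0 n th0; lra.
have sumF : (\sum_(n <oo) P (F n) < +oo)%E.
  apply: (@le_lt_trans _ _ (D / (1 - th))%:E); last by rewrite ltry.
  apply: lime_le.
    by apply: is_cvg_nneseries => n _ _; exact: measure_ge0.
  apply: nearW => n; apply: (@le_trans _ _ (\sum_(0 <= k < n) (D * th ^+ k))%:E).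
    2: by rewrite lee_fin; exact: (geo n).
  rewrite -sumEFin; apply: lee_sum => k _.
  apply: (le_trans (PA _ (leq_addr _ _))); rewrite lee_fin; apply: ler_wpM2l => //.
  by rewrite exprD ler_piMl ?exprn_ge0 // exprn_ile1 // ltW.
have P0 := lim_sup_set_cvg0 mF sumF.
exists (lim_sup_set F); split => //.
  by apply: bigcapT_measurable => n; apply: bigcup_measurable => k _; exact: mF.
move=> w /= nAw n _; apply: contrapT => nF; apply: nAw.
exists (k0 + n)%N => k kn Ak; apply: nF.
exists (k - k0)%N => /=; first by rewrite leq_subRL // (leq_trans (leq_addr n k0)).
by rewrite /F subnKC // (leq_trans (leq_addr n k0)).
Qed.

Section Sandwich.
Context {R : realType} (x : nat -> nat).
Hypothesis x_gt0 : (0 < x 0)%N.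
Hypothesis x_mono : forall s t, (s <= t)%N -> (x s <= x t)%N.

Let x_pos t : 0 < (x t)%:R :> R.
Proof. by rewrite ltr0n (leq_trans x_gt0) // x_mono. Qed.

Let ln_x_mono s t : (s <= t)%N -> ln (x s)%:R <= ln (x t)%:R :> R.
Proof. by move=> st; rewrite ler_ln ?posrE // ler_nat x_mono. Qed.

Lemma ln_nat_large (X : R) : exists t0, forall t, (t0 <= t)%N -> X <= ln t%:R.
Proof.
exists (Num.bound (expR X)) => t ht.
have Xt : expR X < t%:R.
  apply: (@lt_le_trans _ _ (Num.bound (expR X))%:R); last by rewrite ler_nat.
  exact: archi_boundP (expR_ge0 _).
by rewrite -[X]expRK ler_ln ?posrE ?expR_gt0 ?(lt_trans (expR_gt0 X)) // ltW.
Qed.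

Lemma ln_pow2_bracket M t (k := trunc_log (2 ^ M) t) : (0 < M)%N -> (0 < t)%N ->
  [/\ (2 ^ (M * k) <= t < 2 ^ (M * k.+1))%N,
      M%:R * k%:R * ln 2 <= ln t%:R :> R & ln t%:R <= M%:R * k.+1%:R * ln 2 :> R].
Proof.
move=> M0 t0; have M1 : (1 < 2 ^ M)%N by rewrite -{1}(expn0 2) ltn_exp2l.
have /andP[kt tk] := trunc_log_bounds M1 t0; rewrite -!expnM in kt tk.
have pow j : ln (2 ^ (M * j))%:R = M%:R * j%:R * ln 2 :> R.
  by rewrite natrX lnXn // -natrM mulr_natl.
rewrite -!pow !ler_ln ?posrE ?ltr0n ?expn_gt0 // !ler_nat; split=> //.
  by rewrite kt.
exact: ltnW.
Qed.

(** Rounding [t] up to the next [2 ^ (M * k)] costs at most [al], and [C + al] is at most [e * ln t]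
    for large [t]. *)
Lemma upper_sandwich M (C al e : R) k0 : (0 < M)%N -> 0 <= al -> 0 < e ->
  (forall k, (k0 <= k)%N -> ln (x (2 ^ (M * k)))%:R <= C + al * k%:R) ->
  \forall t \near \oo, ln (x t)%:R / ln t%:R <= al / (M%:R * ln 2) + e.
Proof.
move=> M0 al0 e0 hx.
have ln2 : 0 < ln 2 :> R by rewrite ln_gt0 // ltr1n.
have Mln : 0 < M%:R * ln 2 :> R by rewrite mulr_gt0 // ltr0n.
have [t0 ht0] := ln_nat_large (Num.max 1 ((C + al) / e)).
exists (maxn t0 (maxn 1 (2 ^ (M * k0)))) => // t /=.
rewrite !geq_max => /and3P[/ht0]; rewrite ge_max => /andP[lt1 lte] t1 tk0.
have lnt0 : 0 < ln t%:R :> R by rewrite (lt_le_trans ltr01).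
have [/andP[kt tk] kl _] := ln_pow2_bracket M0 t1.
set k := trunc_log _ _ in kt tk kl.
have k0k : (k0 <= k.+1)%N.
  by have := leq_ltn_trans tk0 tk; rewrite ltn_exp2l // ltn_pmul2l // => /ltnW.
rewrite ler_pdivrMr //; apply: (le_trans (ln_x_mono (ltnW tk))).
apply: (le_trans (hx _ k0k)).
have : al * k%:R <= al / (M%:R * ln 2) * ln t%:R.
  rewrite -mulrA; apply: ler_wpM2l => //.
  by rewrite mulrC ler_pdivlMr // mulrCA mulrA.
rewrite ler_pdivrMr // in lte.
rewrite -natr1; lra.
Qed.

(** The bound holds at twice a power of 2, so one more index is given up to stay below [t]; hence
    [2 * al] in the threshold. *)
Lemma lower_sandwich M (C al e : R) k0 : (0 < M)%N -> 0 <= al -> 0 < e ->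
  (forall k, (k0 <= k)%N ->
    al * k%:R - C <= ln (x (2 ^ (M * k) + 2 ^ (M * k)))%:R) ->
  \forall t \near \oo, al / (M%:R * ln 2) - e <= ln (x t)%:R / ln t%:R.
Proof.
move=> M0 al0 e0 hx.
have ln2 : 0 < ln 2 :> R by rewrite ln_gt0 // ltr1n.
have Mln : 0 < M%:R * ln 2 :> R by rewrite mulr_gt0 // ltr0n.
have [t0 ht0] := ln_nat_large (Num.max 1 ((C + 2 * al) / e)).
exists (maxn t0 (maxn 1 (2 ^ (M * k0.+1)))) => // t /=.
rewrite !geq_max => /and3P[/ht0]; rewrite ge_max => /andP[lt1 lte] t1 tk0.
have lnt0 : 0 < ln t%:R :> R by rewrite (lt_le_trans ltr01).
have [/andP[kt tk] _ kl] := ln_pow2_bracket M0 t1.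
set k := trunc_log _ _ in kt tk kl.
have : (k0.+1 < k.+1)%N by have := leq_ltn_trans tk0 tk; rewrite ltn_exp2l // ltn_pmul2l.
case: k kt tk kl => [//|k] kt tk kl; rewrite !ltnS => k0k.
rewrite ler_pdivlMr //.
have kt' : (2 ^ (M * k) + 2 ^ (M * k) <= t)%N.
  by apply: leq_trans kt; rewrite addnn -mul2n -expnS leq_exp2l // mulnS -add1n leq_add.
apply: le_trans (ln_x_mono kt'); apply: le_trans (hx _ k0k).
have : al / (M%:R * ln 2) * ln t%:R <= al * k.+2%:R.
  rewrite -mulrA; apply: ler_wpM2l => //.
  by rewrite mulrC ler_pdivrMr // mulrCA mulrA.
rewrite ler_pdivrMr // in lte.
rewrite -!natr1; lra.
Qed.

End Sandwich.

(** * Geometric bounds on [f] at powers of 2 *)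

Section Potter.
Context {R : realType} (f : R -> R) (gamma : R).
Hypothesis f_range : forall x : R, 0 < x -> 0 < f x <= 1.
Hypothesis f_to0 : f x @[x --> +oo] --> (0 : R).
Hypothesis f_rv : regularly_varying f (- gamma).

Let r : R := 2 `^ (- gamma).

Lemma near_pinfty_nat (Q : R -> Prop) : (\forall x \near +oo, Q x) ->
  exists n0, forall n, (n0 <= n)%N -> Q n%:R.
Proof.
move=> [A [_ hA]]; exists (Num.bound `|A|) => n hn; apply: hA.
rewrite (le_lt_trans (ler_norm A)) // (lt_le_trans (archi_boundP (normr_ge0 A))) //.
by rewrite ler_nat.
Qed.

Lemma f_small_nat (e : R) : 0 < e -> exists n0, forall n, (n0 <= n)%N -> f n%:R <= e.
Proof.
move=> e0; apply: (near_pinfty_nat (Q := fun x => f x <= e)).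
by move/cvgrPdist_le: f_to0 => /(_ _ e0); apply: filterS => x; rewrite sub0r normrN;
  exact: le_trans (ler_norm _).
Qed.

Lemma near_pow2 (Q : R -> Prop) : (\forall x \near +oo, Q x) ->
  exists k0, forall k, (k0 <= k)%N -> Q (2 ^+ k).
Proof.
move=> /near_pinfty_nat[n0 hn0]; exists n0 => k hk; rewrite -natrX; apply: hn0.
by rewrite (leq_trans hk) // ltnW // ltn_expl.
Qed.

Lemma f_pow2_gt0 k : 0 < f (2 ^+ k).
Proof. by case/andP: (f_range (exprn_gt0 k (ltr0Sn R 1))). Qed.

(** The successive ratios of [f (2 ^+ k)] tend to [r], hence are eventually at most [q]: a discrete
    form of Potter's bound. *)
Lemma potter_upper (q : R) : r < q ->
  exists2 C, 1 <= C & forall k, f (2 ^+ k) <= C * q ^+ k.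
Proof.
move=> rq; have r0 : 0 < r by exact: powR_gt0.
have q0 : 0 < q := lt_trans r0 rq.
have cv := f_rv.2 2 (ltr0Sn R 1).
have [k0 hk0] : exists k0, forall k, (k0 <= k)%N -> f (2 * 2 ^+ k) / f (2 ^+ k) <= q.
  apply: (near_pow2 (Q := fun x => f (2 * x) / f x <= q)).
  exact: (cvgr_le _ cv).
apply: (ratio_upper_bound q0) => k /hk0; rewrite exprS ler_pdivrMr //.
exact: f_pow2_gt0.
Qed.

(** The ratio argument is applied to the inverse of [f]. *)
Lemma potter_lower (q : R) : 0 < q -> q < r ->
  exists2 c, 0 < c & forall k, c * q ^+ k <= f (2 ^+ k).
Proof.
move=> q0 qr; have cv := f_rv.2 2 (ltr0Sn R 1).
have [k0 hk0] : exists k0, forall k, (k0 <= k)%N -> q <= f (2 * 2 ^+ k) / f (2 ^+ k).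
  apply: (near_pow2 (Q := fun x => q <= f (2 * x) / f x)).
  exact: (cvgr_ge _ cv).
have qV0 : 0 < q^-1 by rewrite invr_gt0.
have [C C1 hC] : exists2 C, 1 <= C & forall k, (f (2 ^+ k))^-1 <= C * q^-1 ^+ k.
  apply: (ratio_upper_bound (x := fun k => (f (2 ^+ k))^-1) (k0 := k0) qV0) => k /hk0.
  have := f_pow2_gt0 k; have := f_pow2_gt0 k.+1; rewrite exprS => f1 f0.
  by rewrite ler_pdivlMr // -invfM lef_pV2 ?posrE // mulr_gt0.
have C0 : 0 < C := lt_le_trans ltr01 C1.
exists C^-1 => [|k]; first by rewrite invr_gt0.
have := hC k; rewrite exprVn -[C in C / _]invrK -invfM lef_pV2 ?posrE ?f_pow2_gt0 //.
by rewrite mulr_gt0 ?invr_gt0 ?exprn_gt0.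
Qed.

End Potter.

(** * Almost sure convergence *)

Section AlmostSure.
Context {R : realType} (f : R -> R) (gamma : R) d (T : measurableType d)
  (P : probability T R) (Z : nat -> {RV P >-> bool}) (G : nat -> T -> multigraph).
Hypothesis f_range : forall x : R, 0 < x -> 0 < f x <= 1.
Hypothesis f_decr : forall x y : R, 0 < x -> x <= y -> f y <= f x.
Hypothesis f_to0 : f x @[x --> +oo] --> (0 : R).
Hypothesis gamma_range : 0 <= gamma < 1.
Hypothesis f_rv : regularly_varying f (- gamma).
Hypothesis process : edge_step_process f Z G.

Let f01 := f01_nat f_range.

Lemma measurable_graph_event t (a : pred multigraph) : measurable [set w | a (G t w)].
Proof. exact: (measurable_fiberP [set g | a g]) (measurable_graph process t). Qed.

Let b : R := 1 - gamma.

Let two_r : 2 * 2 `^ (- gamma) = expR (b * ln 2) :> R.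
Proof. by rewrite /b mulrBl mul1r expRD lnK ?posrE // /powR pnatr_eq0 /= mulNr. Qed.

(** The [3 * eta] collects one [eta] from [q], taken above [2 ^ (- gamma)], and two from [rho ^+ 2].
    The times are [4 ^ k], whence the denominator [2 * ln 2]. *)
Lemma ae_log_clique_upper (eta e : R) : 0 < eta -> 0 < e -> {ae P, forall w,
  \forall t \near \oo, ln (clique_number (G t w))%:R / ln t%:R <=
     (b * ln 2 + 3 * eta) / (2 * ln 2) + e}.
Proof.
move=> eta0 e0; pose rho := expR eta.
have rho1 : 1 < rho by rewrite /rho expR_gt1.
have r0 : 0 < 2 `^ (- gamma) :> R by exact: powR_gt0.
pose q := 2 `^ (- gamma) * rho.
have rq : 2 `^ (- gamma) < q by rewrite /q ltr_pMr.
have q2E : 2 * q = expR (b * ln 2 + eta) by rewrite /q mulrA two_r expRD.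
have ln2 : 0 < ln 2 :> R by rewrite ln_gt0 // ltr1n.
have b0 : 0 < b by rewrite subr_gt0; case/andP: gamma_range.
have bl0 : 0 < b * ln 2 by rewrite mulr_gt0.
have q1 : 1 <= 2 * q by rewrite q2E -[leLHS]expR0 ler_expR; lra.
have [C C1 fC] := potter_upper f_range f_rv rq.
have [D hD] := clique_upper_tail f_range f_decr C1 q1 rho1 fC.
have thE : 0 <= rho^-1 < 1 by rewrite invr_ge0 ltW ?expR_gt0 //= invf_lt1 ?expR_gt0.
have D0 : 0 <= D.
  have := hD 0%N; rewrite [leRHS]mulr1; apply: le_trans.
  by apply: (Ex_ge0 f01) => [h _|]; [exact: ler0n|exact: reachable_loop].
pose A k := [set w | (2 * (2 * q * rho ^+ 2) ^+ k < (clique_number (G (4 ^ k) w))%:R)%R].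
have mA k : measurable (A k).
  exact: (measurable_graph_event (4 ^ k)
    (fun g => (2 * (2 * q * rho ^+ 2) ^+ k < (clique_number g)%:R)%R)).
have PA k : (0 <= k)%N -> (P (A k) <= (D * rho^-1 ^+ k)%:E)%E.
  move=> _; apply: (le_trans (prob_graph_le f01 process (4 ^ k)
    (fun g => (2 * (2 * q * rho ^+ 2) ^+ k < (clique_number g)%:R)%R))).
  by rewrite lee_fin; exact: hD.
have := borel_cantelli_geometric mA D0 thE PA.
have := ae_clique_number_nondecreasing f01 process.
apply: filterS2 => w [G0 mono] [k1 hk1].
have al0 : 0 <= b * ln 2 + 3 * eta by lra.
apply: (upper_sandwich (M := 2) (C := ln 2) (k0 := k1) G0 mono _ al0 e0) => // k /hk1.
rewrite /A /= => /negP; rewrite -leNgt expnM => hle.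
have cpos : 0 < (clique_number (G (4 ^ k) w))%:R :> R.
  by rewrite ltr0n (leq_trans G0) // mono.
have E : 2 * (2 * q * rho ^+ 2) ^+ k = expR (ln 2 + (b * ln 2 + 3 * eta) * k%:R).
  rewrite expRD lnK ?posrE // expRM_natr q2E /rho -expRM_natl -expRD.
  by congr (2 * expR _ ^+ k); ring.
rewrite E in hle.
by rewrite -[leRHS]expRK ler_ln ?posrE ?expR_gt0.
Qed.

Lemma ae_log_clique_lower N (eta e : R) : (0 < N)%N -> 0 < eta -> eta < b * ln 2 -> 0 < e ->
  {ae P, forall w, \forall t \near \oo,
     (N%:R * (b * ln 2 - eta)) / ((2 * N + 4)%:R * ln 2) - e <=
       ln (clique_number (G t w))%:R / ln t%:R}.
Proof.
move=> N0 eta0 etab e0.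
have r0 : 0 < 2 `^ (- gamma) :> R by exact: powR_gt0.
pose q := 2 `^ (- gamma) * expR (- eta).
have q0 : 0 < q by rewrite mulr_gt0 ?expR_gt0.
have qr : q < 2 `^ (- gamma) by rewrite /q gtr_pMr // expR_lt1 oppr_lt0.
have q2E : 2 * q = expR (b * ln 2 - eta) by rewrite /q mulrA two_r -expRD.
have q1 : 1 < 2 * q by rewrite q2E expR_gt1 subr_gt0.
have [c c0 fc] := potter_lower f_range f_rv q0 qr.
have [D [th [k0 [D0 th1 hD]]]] :=
  clique_lower_tail f_range f_decr (f_small_nat f_to0) c0 q1 N0 fc.
set M := (2 * N + 4)%N.
pose A k := [set w | ((clique_number (G (2 ^ (M * k) + 2 ^ (M * k)) w))%:R
   < c * (2 * q) ^+ (N * k) / 8)%R].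
have mA k : measurable (A k).
  exact: (measurable_graph_event (2 ^ (M * k) + 2 ^ (M * k))
    (fun g => ((clique_number g)%:R < c * (2 * q) ^+ (N * k) / 8)%R)).
have PA k : (k0 <= k)%N -> (P (A k) <= (D * th ^+ k)%:E)%E.
  move=> k0k; apply: (le_trans (prob_graph_le f01 process (2 ^ (M * k) + 2 ^ (M * k))
    (fun g => ((clique_number g)%:R < c * (2 * q) ^+ (N * k) / 8)%R))).
  by rewrite lee_fin; exact: hD.
have := borel_cantelli_geometric mA D0 th1 PA.
have := ae_clique_number_nondecreasing f01 process.
apply: filterS2 => w [G0 mono] [k1 hk1].
have al0 : 0 <= N%:R * (b * ln 2 - eta) by rewrite mulr_ge0 // subr_ge0 ltW.
have M0 : (0 < M)%N by rewrite /M addn4.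
apply: (lower_sandwich (M := M) (C := - ln (c / 8)) (k0 := k1) G0 mono M0 al0 e0).
move=> k /hk1; rewrite /A /= => /negP; rewrite -leNgt => hle.
have E : c * (2 * q) ^+ (N * k) / 8 =
    expR (N%:R * (b * ln 2 - eta) * k%:R - - ln (c / 8)).
  rewrite expRD opprK lnK ?posrE ?divr_gt0 // expRM_natr expRM_natl -q2E -exprM.
  by rewrite mulrAC [RHS]mulrC.
rewrite E in hle.
rewrite -[leLHS]expRK ler_ln ?posrE ?expR_gt0 //.
by rewrite ltr0n (leq_trans G0) // mono.
Qed.

End AlmostSure.

Theorem corollary1p3 (R : realType) (f : R -> R) (gamma : R)
  (f_range : forall x : R, 0 < x -> 0 < f x <= 1)
  (f_decr : forall x y : R, 0 < x -> x <= y -> f y <= f x)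
  (f_to0 : f x @[x --> +oo] --> (0 : R))
  (gamma_range : 0 <= gamma < 1)
  (f_rv : regularly_varying f (- gamma))
  (d : measure_display) (T : measurableType d) (P : probability T R)
  (Z : nat -> {RV P >-> bool}) (G : nat -> T -> multigraph)
  (process : edge_step_process f Z G) :
  {ae P, forall w,
    ln (clique_number (G t w))%:R / ln t%:R @[t --> \oo]
      --> (1 - gamma) / 2 }.
Proof.
have ln2 : 0 < ln 2 :> R by rewrite ln_gt0 // ltr1n.
have g1 : 0 < 1 - gamma by rewrite subr_gt0; case/andP: gamma_range.
have g1' : 1 - gamma <= 1 by case/andP: gamma_range => g0 _; lra.
have m0 m : 0 < m.+1%:R^-1 :> R by rewrite invr_gt0.
have m1 m : m.+1%:R^-1 <= 1 :> R by rewrite invf_le1 ?ler1n.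
have upper m : {ae P, forall w, \forall t \near \oo,
    ln (clique_number (G t w))%:R / ln t%:R <= (1 - gamma) / 2 + 3 * m.+1%:R^-1}.
  have eta0 : 0 < ln 2 * m.+1%:R^-1 :> R := mulr_gt0 ln2 (m0 m).
  have := ae_log_clique_upper f_range f_decr gamma_range f_rv process eta0 (m0 m).
  apply: filterS => w; apply: filterS => t /le_trans; apply.
  have -> : ((1 - gamma) * ln 2 + 3 * (ln 2 * m.+1%:R^-1)) / (2 * ln 2) =
      (1 - gamma) / 2 + 3 / 2 * m.+1%:R^-1.
    by move: (m.+1%:R^-1 : R) => x; field; rewrite gt_eqF.
  by have := m0 m; move: (m.+1%:R^-1 : R) => x x0; lra.
have lower m : {ae P, forall w, \forall t \near \oo,
    (1 - gamma) / 2 - 3 * m.+1%:R^-1 <= ln (clique_number (G t w))%:R / ln t%:R}.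
  (* Here [N = m.+1]: a single parameter sends [N] to infinity and [eta] and the error to 0. In
     terms of [x = 1 / N], the ratio [N / (2 * N + 4)] is [1 / (2 + 4 * x)]. *)
  have eta0 : 0 < (1 - gamma) * ln 2 * (m.+1%:R^-1 / 2) by rewrite !mulr_gt0.
  have etab : (1 - gamma) * ln 2 * (m.+1%:R^-1 / 2) < (1 - gamma) * ln 2.
    by rewrite gtr_pMr ?mulr_gt0 //; have := m1 m; move: (m.+1%:R^-1 : R) => x x1; lra.
  have := ae_log_clique_lower f_range f_decr f_to0 f_rv process (ltn0Sn m) eta0 etab (m0 m).
  apply: filterS => w; apply: filterS => t; apply: le_trans.
  set x := m.+1%:R^-1.
  have -> : m.+1%:R * ((1 - gamma) * ln 2 - (1 - gamma) * ln 2 * (x / 2)) /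
      ((2 * m.+1 + 4)%:R * ln 2) - x =
      (1 - gamma) * (1 - x / 2) / (2 + 4 * x) - x.
    rewrite natrD natrM /x; have := ltr0Sn R m; move: (m.+1%:R : R) => y y0.
    by field; rewrite !gt_eqF //; lra.
  have x0 : 0 < x by exact: m0.
  have x1 : x <= 1 by exact: m1.
  suff : (1 - gamma) / 2 - 2 * x <= (1 - gamma) * (1 - x / 2) / (2 + 4 * x) by lra.
  by rewrite ler_pdivlMr; [nra|lra].
have := ae_foralln upper; have := ae_foralln lower.
apply: filterS2 => w hl hu; apply/cvgrPdist_le => e e0.
have e30 : 0 < e / 3 by rewrite divr_gt0.
have [m hm] : exists m, 3 * m.+1%:R^-1 <= e.
  exists (Num.bound (e / 3)^-1); rewrite mulrC -ler_pdivlMr //.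
  rewrite -[leRHS]invrK lef_pV2 ?posrE ?invr_gt0 //.
  rewrite ltW // (lt_le_trans (archi_boundP _)) ?invr_ge0 ?(ltW e30) //.
  by rewrite ler_nat leqnSn.
near=> t; rewrite ler_distlC; apply/andP; split.
- apply: (@le_trans _ _ ((1 - gamma) / 2 - 3 * m.+1%:R^-1)); first by rewrite lerD2l lerN2.
  by near: t; exact: hl.
- apply: (@le_trans _ _ ((1 - gamma) / 2 + 3 * m.+1%:R^-1)); last by rewrite lerD2l.
  by near: t; exact: hu.
Unshelve. all: by end_near.
Qed.
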